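(* Let $\ell\ge 2$ be an integer and let $f\in C^{\ell}(\mathbb{R})$ be nonlinear of order $\ell$. Let $\Omega\subset\mathbb{R}^2$ be an open connected set, with points denoted $(t,x)$, and let $u\in C^0(\Omega)$ and $g\in L^\infty(\Omega)$ be such that \[ \partial_t u+\partial_x\big(f(u)\big)=g\qquad\text{in }\mathcal{D}'(\Omega). \] Then $u\in C^{0,\alpha}_{\mathrm{loc}}(\Omega)$ with $\alpha=\frac1\ell$.
   Context: Nonlinearity: let $I\subset\mathbb{R}$ be an interval. A function $f:I\to\mathbb{R}$ differentiable at $v\in I$ is called nonlinear of order $\ell>1$ with constant $c>0$ at $v$ if there exists $\delta>0$ such that for every $h$ with $v+h\in I$ and $|h|<\delta$ one has $|f(v+h)-f(v)-f'(v)h|\ge c|h|^{\ell}$. The function $f:\mathbb{R}\to\mathbb{R}$ is called nonlinear of order $\ell$ if for every $v\in\mathbb{R}$ it is nonlinear of order $\ell$ at $v$ with some constant $c>0$ (possibly depending on $v$). The equation holds in $\mathcal{D}'(\Omega)$, i.e. $\iint_\Omega \big(u\,\partial_t\varphi+f(u)\,\partial_x\varphi+g\,\varphi\big)\,dt\,dx=0$ for all $\varphi\in C_c^\infty(\Omega)$. $u\in C^{0,\alpha}_{\mathrm{loc}}(\Omega)$ means that for every compact $K\subset\Omega$ there is $C_K$ such that $|u(P)-u(Q)|\le C_K|P-Q|^\alpha$ for all $P,Q\in K$ (Hölder continuity in both variables $(t,x)$). *)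

(* Defs.v *)
From HB Require Import structures.
From mathcomp Require Import all_boot all_order all_algebra.
From mathcomp Require Import all_classical all_reals all_analysis.

Set Implicit Arguments.
Unset Strict Implicit.
Unset Printing Implicit Defensive.

Import Order.TTheory GRing.Theory Num.Theory.
Import numFieldNormedType.Exports.

Local Open Scope classical_set_scope.
Local Open Scope ring_scope.

Definition is_Ck (R : realType) (k : nat) (f : R -> R) : Prop :=
  (forall j x, (j < k)%N -> derivable f^`(j)%classic x 1) /\
  (forall j, (j <= k)%N -> continuous f^`(j)%classic).

Definition nonlinear_at (R : realType) (f : R -> R) (p c v : R) : Prop :=
  derivable f v 1 /\
  exists2 delta : R, 0 < delta &
    forall h : R, `|h| < delta ->
      c * `|h| `^ p <= `|f (v + h) - f v - f^`()%classic v * h|.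

Definition nonlinear (R : realType) (f : R -> R) (p : R) : Prop :=
  1 < p /\ forall v : R, exists2 c : R, 0 < c & nonlinear_at f p c v.

(* Points of the plane are pairs (t, x). *)
Definition dt (R : realType) (phi : R * R -> R) : R * R -> R :=
  'D_((1, 0) : R * R) phi.

Definition dx (R : realType) (phi : R * R -> R) : R * R -> R :=
  'D_((0, 1) : R * R) phi.

Fixpoint is_Ck2 (R : realType) (k : nat) (phi : R * R -> R) : Prop :=
  if k is k'.+1 then
    [/\ forall z, derivable phi z (1, 0),
        forall z, derivable phi z (0, 1),
        is_Ck2 k' (dt phi) & is_Ck2 k' (dx phi)]
    /\ continuous phi
  else continuous phi.

(* A test function on Omega is represented by its extension by 0 to the whole
   plane. *)
Definition test_function (R : realType) (Omega : set (R * R))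
    (phi : R * R -> R) : Prop :=
  [/\ forall k, is_Ck2 k phi,
      compact (closure [set z | phi z != 0]) &
      closure [set z | phi z != 0] `<=` Omega].

Definition lebesgue2 (R : realType) :
    {measure set (measurableTypeR R * measurableTypeR R) -> \bar R} :=
  (@lebesgue_measure R \x @lebesgue_measure R)%E.

Arguments lebesgue2 : clear implicits.

(* Only the values of g on Omega matter.  The measurability contained in Lfun
   is Borel measurability; every class in L^oo(Omega) has such a
   representative. *)
Definition Linfty (R : realType) (Omega : set (R * R)) (g : R * R -> R) : Prop :=
  g \_ Omega \in Lfun (lebesgue2 R) +oo%E.

Definition balance_law (R : realType) (Omega : set (R * R)) (f : R -> R)
    (u g : R * R -> R) : Prop :=
  forall phi : R * R -> R, test_function Omega phi ->
    (\int[lebesgue2 R]_(z in Omega)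
       (u z * dt phi z + f (u z) * dx phi z + g z * phi z)%:E = 0)%E.

Definition euclid_dist (R : realType) (P Q : R * R) : R :=
  Num.sqrt ((P.1 - Q.1) ^+ 2 + (P.2 - Q.2) ^+ 2).

Definition locally_holder (R : realType) (Omega : set (R * R)) (alpha : R)
    (u : R * R -> R) : Prop :=
  forall K : set (R * R), compact K -> K `<=` Omega ->
    exists C : R, forall P Q, K P -> K Q ->
      `|u P - u Q| <= C * euclid_dist P Q `^ alpha.

(* Main.v *)
(* The proof is Lagrangian.  Testing the equation with smoothed indicators of thin
   strips along a line of slope s = f'(u(t, y)) through (t, y) controls the means
   of u over the two one-sided strips.  In a range of values where f' is monotone,
   f(w) - s w is extremal at w = u(t, y), so the flux through the outer edges has a
   sign: one of the means grows at rate at most 2G, the other decreases at rate at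
   most 2G, with G a bound for g.  As both means are close to u(t, y), u changes
   at rate at most 2G, up to an arbitrarily small error, along the Euler polygons
   of dy/dt = f'(u(t, y)), forward and backward in time.

   Nonlinearity of order l says that one of the derivatives of order 2, ..., l of f
   does not vanish at v; hence on each side of v, f' is monotone with
   |f'(b) - f'(a)| >= c (b - a)^(l-1).  Let u differ by w at (t, x1) and (t, x2),
   with values on one side of v.  For a time of order w/G the two polygons carry
   values that stay w/2 apart, hence they cannot meet, while in one of the two
   directions of time they approach at speed at least c (w/2)^(l-1).
   So |x1 - x2| >= C w^l.  For points at different times one first follows a
   polygon to the same time; and two values near v can be replaced, through the
   intermediate value theorem on the segment joining the points, by two values on
   one side of v at a quarter of the distance. *)

Require Import Defs.
From HB Require Import structures.
From mathcomp Require Import all_boot all_order all_algebra.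
From mathcomp Require Import all_classical all_reals all_analysis.
From mathcomp Require Import ess_sup_inf measurable_realfun.
From mathcomp Require Import zify ring lra.

Import Order.TTheory GRing.Theory Num.Theory.
Import numFieldNormedType.Exports.

Local Open Scope classical_set_scope.
Local Open Scope ring_scope.

Set Implicit Arguments.
Unset Strict Implicit.
Unset Printing Implicit Defensive.

(** * Smooth cut-off functions *)

(** A polygon has many pieces, and an error paid on each piece would be fatal. The slice of a strip
    at a fixed time does not depend on the slope, so two consecutive pieces share the same pair of
    means at their common vertex: the increments telescope, and [u] is compared with the means only
    at the first and the last vertex. The error is thus paid once, whatever the number of steps, and
    straight pieces, each served by one sheared test function, replace true characteristics, whose
    existence and uniqueness never come into question. The rate is 2G and not G because the inner
    edge of a strip lies only near the line: its small flux error is absorbed by a second G times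
    the mass of the strip. The two means control [u] from opposite sides, and reversing time
    exchanges their roles. As G is only an upper bound for the source, it may be enlarged; this
    shortens the times of order w/G enough to keep every polygon inside the box where the equation
    is used. *)

Fixpoint smooth_upto (R : realType) (k : nat) (A : R -> R) : Prop :=
  if k is k'.+1 then
    exists dA : R -> R, (forall x, is_derive x (1 : R) A (dA x)) /\ smooth_upto k' dA
  else continuous A.

Lemma smooth_uptoW (R : realType) k (A : R -> R) :
  smooth_upto k.+1 A -> smooth_upto k A.
Proof.
elim: k A => [|k IH] A /= [dA [dAP sA]]; last by exists dA; split => //; exact: IH.
move=> x; apply: differentiable_continuous; apply/derivable1_diffP.
exact: ex_derive.
Qed.

Lemma smooth_uptoD (R : realType) k (A B : R -> R) :
  smooth_upto k A -> smooth_upto k B -> smooth_upto k (fun x => A x + B x).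
Proof.
elim: k A B => [|k IH] A B /=; first by move=> cA cB x; exact: cvgD (cA x) (cB x).
move=> [dA [dAP sA]] [dB [dBP sB]].
by exists (fun x => dA x + dB x); split; [move=> x; exact: is_deriveD|exact: IH].
Qed.

Lemma smooth_uptoM (R : realType) k (A B : R -> R) :
  smooth_upto k A -> smooth_upto k B -> smooth_upto k (fun x => A x * B x).
Proof.
elim: k A B => [|k IH] A B; first by move=> cA cB x; exact: cvgM (cA x) (cB x).
move=> sA sB; move: (sA) (sB) => [dA [dAP sdA]] [dB [dBP sdB]].
exists (fun x => A x * dB x + B x * dA x); split.
  by move=> x; exact: is_deriveM.
by apply: smooth_uptoD; apply: IH => //; exact: smooth_uptoW.
Qed.

Lemma smooth_upto_cst (R : realType) k (c : R) : smooth_upto k (fun=> c).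
Proof.
elim: k c => [|k IH] c /=; first by move=> x; exact: cvg_cst.
by exists (fun=> 0); split => // x; exact: is_derive_cst.
Qed.

Lemma smooth_uptoV (R : realType) k (A : R -> R) : (forall x, A x != 0) ->
  smooth_upto k A -> smooth_upto k (fun x => (A x)^-1).
Proof.
move=> A0; elim: k => [|k IH]; first by move=> cA x; apply: cvgV => //; exact: cA.
move=> sA; move: (sA) => [dA [dAP sdA]].
exists (fun x => - 1 * (dA x * ((A x)^-1 * (A x)^-1))); split.
  move=> x; apply: (is_derive_eq (@is_deriveV R A x _ 1 (A0 x) (dAP x))).
  by rewrite -[LHS]/(_ * _) mulN1r mulNr -exprVn expr2 mulrC.
have sV := IH (smooth_uptoW sA).
apply: smooth_uptoM (smooth_upto_cst _ _) _.
by apply: smooth_uptoM sdA _; exact: smooth_uptoM.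
Qed.

Lemma is_derive_affine (R : realType) (A : R -> R) (p q x d : R) :
  is_derive (p * x + q) (1 : R) A d ->
  is_derive x (1 : R) (fun x => A (p * x + q)) (p * d).
Proof.
move=> dA; have h : is_derive x (1 : R) (fun x => p * x + q) p.
  have -> : (fun x => p * x + q) = (p *: id + cst q : R -> R) by [].
  by apply: is_derive_eq; rewrite addr0 /GRing.scale /= mulr1.
rewrite [p * d]mulrC; exact: (@is_derive1_comp R A (fun x => p * x + q) x d p dA h).
Qed.

Lemma smooth_upto_affine (R : realType) k (A : R -> R) (p q : R) :
  smooth_upto k A -> smooth_upto k (fun x => A (p * x + q)).
Proof.
elim: k A => [|k IH] A /=.
  move=> cA x; apply: (@continuous_comp _ _ _ (fun x => p * x + q)); last exact: cA.
  by apply: cvgD; [apply: cvgM; [exact: cvg_cst|exact: cvg_id]|exact: cvg_cst].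
move=> [dA [dAP sA]]; exists (fun x => p * dA (p * x + q)); split.
  by move=> x; exact: is_derive_affine.
by apply: smooth_uptoM; [exact: smooth_upto_cst|exact: IH].
Qed.

(* The derivative of [flat_exp n] is a combination of [flat_exp n.+2] and
   [flat_exp n.+1], so the family is closed under differentiation. *)
Definition flat_exp (R : realType) (n : nat) (x : R) : R :=
  if 0 < x then x^-1 ^+ n * expR (- x^-1) else 0.

(** With y = 1/x and m = n + 2 this is y^n e^(-y) <= m^m y^(-2), which follows from e^y =
    (e^(y/m))^m >= (y/m)^m. *)
Lemma flat_exp_le (R : realType) n (x : R) :
  0 <= flat_exp n x <= n.+2%:R ^+ n.+2 * x ^+ 2.
Proof.
rewrite /flat_exp; case: ifPn => [x0|_]; last first.
  by rewrite lexx mulr_ge0 ?sqr_ge0 ?exprn_ge0.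
apply/andP; split; first by rewrite mulr_ge0 ?expR_ge0 ?exprn_ge0 ?invr_ge0 ?ltW.
suff h y : 0 < y -> y ^+ n * expR (- y) <= n.+2%:R ^+ n.+2 * y^-1 ^+ 2 :> R.
  by have := h x^-1; rewrite invr_gt0 invrK; exact.
move=> y0; have h : (y / n.+2%:R) ^+ n.+2 <= expR y.
  have -> : expR y = expR (y / n.+2%:R) ^+ n.+2.
    by rewrite -expRM_natr divfK// pnatr_eq0.
  apply: lerXn2r; rewrite ?nnegrE ?expR_ge0 ?divr_ge0 ?ltW//.
  have := expR_ge1Dx (y / n.+2%:R).
  by move: (y / _) => z; lra.
rewrite expRN ler_pdivrMr ?expR_gt0//.
have c0 : 0 <= n.+2%:R ^+ n.+2 * y^-1 ^+ 2 :> R.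
  by rewrite mulr_ge0 ?sqr_ge0 ?exprn_ge0.
apply: le_trans (ler_wpM2l c0 h).
have n0 : (n.+2%:R : R) ^+ n.+2 != 0 by rewrite expf_neq0 ?pnatr_eq0.
rewrite expr_div_n -[in X in _ <= _ * (X / _)]addn2 exprD le_eqVlt; apply/orP; left.
by apply/eqP; field; rewrite n0 gt_eqF.
Qed.

Lemma is_derive_flat_exp (R : realType) n (x : R) :
  is_derive x (1 : R) (flat_exp n) (flat_exp n.+2 x - n%:R * flat_exp n.+1 x).
Proof.
have [x0|x0|->] := ltgtP x 0.
- rewrite /flat_exp ltNge (ltW x0) /= mulr0 subr0.
  apply: (@near_eq_is_derive R R R (cst 0)).
  near=> y; rewrite ifF//; apply/negbTE; rewrite -leNgt; apply: ltW; near: y.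
  exact: lt_nbhsl.
- apply: (@near_eq_is_derive R R R (fun x => x^-1 ^+ n * expR (- x^-1))).
  + by near=> y; rewrite /flat_exp ifT//; near: y; exact: lt_nbhsr.
  + have xn0 : x != 0 by rewrite gt_eqF.
    have dV : is_derive x (1 : R) (fun y : R => y^-1) (- x ^- 2).
      apply: is_derive_eq; first exact: (@is_deriveV _ id x 1 1 xn0 _).
      by rewrite /GRing.scale /= mulr1.
    have dE : is_derive x (1 : R) (fun y : R => expR (- y^-1)) (expR (- x^-1) * x ^- 2).
      apply: (@is_derive1_comp _ expR (fun y : R => - y^-1)).
      by rewrite -[x ^- 2]opprK; exact: is_deriveN.
    have dX : is_derive x (1 : R) (fun y : R => y^-1 ^+ n) (- n%:R * x^-1 ^+ n.+1).
      have -> : (fun y : R => y^-1 ^+ n) = GRing.inv ^+ n by rewrite exprfctE.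
      apply: (is_derive_eq (@is_deriveX R R GRing.inv n x 1 _ dV)).
      case: n => [|n]; first by rewrite mul0r scale0r oppr0 mul0r.
      by rewrite -[LHS]/(_ * _) /= -exprVn !exprS; ring.
    apply: (is_derive_eq (@is_deriveM _ _ _ _ _ _ _ _ dX dE)).
    by rewrite /flat_exp x0 -[X in X + _]/(_ * _) -[X in _ + X]/(_ * _) -exprVn !exprS; ring.
- have F0 m : flat_exp m 0 = 0 :> R by rewrite /flat_exp ltxx.
  (* At 0 the difference quotient of [flat_exp n] is [flat_exp n.+1], which is continuous there by
     the quadratic bound. *)
  rewrite !F0 mulr0 subr0; apply/is_derive1_caratheodory.
  exists (flat_exp n.+1); split => //.
    move=> z; rewrite F0 !subr0 /flat_exp; case: ifPn => [z0|_]; last by rewrite mul0r.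
    by rewrite exprS; field; rewrite gt_eqF.
  rewrite /prop_for /continuous_at F0.
  apply: (@squeeze_cvgr _ _ _ _ (cst 0) (fun z => n.+3%:R ^+ n.+3 * z ^+ 2)).
  + by near=> z; exact: flat_exp_le.
  + exact: cvg_cst.
  + have : continuous (fun z : R => n.+3%:R ^+ n.+3 * z ^+ 2).
      by move=> z; apply: cvgM; [exact: cvg_cst|exact: exprn_continuous].
    by move=> /(_ 0); rewrite /continuous_at expr0n mulr0.
Unshelve. all: by end_near. Qed.

Lemma smooth_flat_exp (R : realType) k n : smooth_upto k (@flat_exp R n).
Proof.
elim: k n => [|k IH] n.
  move=> x; apply: differentiable_continuous; apply/derivable1_diffP.
  by case: (@is_derive_flat_exp R n x).
exists (fun x => flat_exp n.+2 x + (- n%:R) * flat_exp n.+1 x); split.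
  by move=> x; rewrite mulNr; exact: is_derive_flat_exp.
by apply: smooth_uptoD => //; apply: smooth_uptoM => //; exact: smooth_upto_cst.
Qed.

(** The step is F(x) / (F(x) + F(1 - x)) with F(x) = e^(-1/x) for x > 0 and 0 otherwise; the
    denominator is positive because x or 1 - x is. In the quotient rule the terms F F' cancel, which
    leaves a sum of nonnegative products vanishing off [0, 1]. *)
Lemma exists_smooth_step (R : realType) : exists H dH : R -> R,
  [/\ forall k, smooth_upto k H, forall x, is_derive x (1 : R) H (dH x),
      continuous dH, forall x, 0 <= dH x & [/\ forall x, x <= 0 -> H x = 0,
      forall x, 1 <= x -> H x = 1 & forall x, x \notin `[0, 1] -> dH x = 0]].
Proof.
pose F := @flat_exp R 0; pose dF := @flat_exp R 2.
pose G x := F (- 1 * x + 1); pose dG x := - 1 * dF (- 1 * x + 1).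
have dFP x : is_derive x (1 : R) F (dF x).
  by have := is_derive_flat_exp 0 x; rewrite mul0r subr0.
have dGP x : is_derive x (1 : R) G (dG x) by apply: is_derive_affine.
have F_ge0 x : 0 <= F x by case/andP: (flat_exp_le 0 x).
have dF_ge0 x : 0 <= dF x by case/andP: (flat_exp_le 2 x).
have F_gt0 x : 0 < x -> 0 < F x.
  by move=> x0; rewrite /F /flat_exp x0 mulr_gt0 ?exprn_gt0 ?invr_gt0 ?expR_gt0.
have F0 x : x <= 0 -> F x = 0 by rewrite /F /flat_exp leNgt => /negbTE ->.
have dF0 x : x <= 0 -> dF x = 0 by rewrite /dF /flat_exp leNgt => /negbTE ->.
have S_gt0 x : 0 < F x + G x.
  have [x0|x0] := ltP 0 x; first by rewrite ltr_pwDl ?F_gt0 ?F_ge0.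
  by rewrite ltr_wpDl ?F_ge0// F_gt0//; lra.
have Sn0 x : F x + G x != 0 by rewrite gt_eqF.
have sF k : smooth_upto k F by exact: smooth_flat_exp.
have sG k : smooth_upto k G by apply: smooth_upto_affine.
have sV k : smooth_upto k (fun x => (F x + G x)^-1).
  by apply: smooth_uptoV => //; exact: smooth_uptoD.
pose H x := F x * (F x + G x)^-1.
pose dH x := (dF x * G x + F x * dF (- 1 * x + 1)) * ((F x + G x)^-1 * (F x + G x)^-1).
exists H, dH; split.
- by move=> k; exact: smooth_uptoM.
- move=> x.
  have dS : is_derive x (1 : R) (fun x => F x + G x) (dF x + dG x) by exact: is_deriveD.
  have dV := @is_deriveV R (fun x => F x + G x) x _ 1 (Sn0 x) dS.
  apply: (is_derive_eq (@is_deriveM _ _ _ _ _ _ _ _ (dFP x) dV)).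
  by rewrite -[X in X + _]/(_ * _) -[X in _ + X]/(_ * _) -[X in _ * X]/(_ * _) /dH /dG; field.
- have s0 : smooth_upto 0 dF by exact: smooth_flat_exp.
  have sV0 := sV 0%N.
  suff : smooth_upto 0 dH by [].
  apply: smooth_uptoM; last exact: smooth_uptoM.
  exact: smooth_uptoD (smooth_uptoM s0 (sG 0%N))
    (smooth_uptoM (sF 0%N) (smooth_upto_affine (-1) 1 s0)).
- move=> x; apply: mulr_ge0; last by rewrite -expr2 sqr_ge0.
  by rewrite addr_ge0 ?mulr_ge0 ?F_ge0.
- split.
  + by move=> x x0; rewrite /H F0 ?mul0r.
  + move=> x x1; rewrite /H.
    have G0 : G x = 0 by rewrite /G F0//; lra.
    by rewrite -[X in X * _](addr0 (F x)) -G0 mulfV.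
  + move=> x; rewrite in_itv /= negb_and -!ltNge => /orP[x0|x1].
      by rewrite /dH dF0 ?F0 ?(ltW x0)// !mul0r addr0 mul0r.
    by rewrite /dH [G x]F0 ?[dF (_ + _)]dF0 ?mulr0 ?addr0 ?mul0r//; lra.
Qed.

(** * Product test functions *)

Lemma is_Ck2D (R : realType) k (phi psi : R * R -> R) :
  is_Ck2 k phi -> is_Ck2 k psi -> is_Ck2 k (fun z => phi z + psi z).
Proof.
elim: k phi psi => [|k IH] phi psi /=.
  by move=> cp cq z; exact: cvgD (cp z) (cq z).
move=> [[pt px pdt pdx] cp] [[qt qx qdt qdx] cq].
have dtD : dt (fun z => phi z + psi z) = (fun z => dt phi z + dt psi z).
  by apply/funext => z; exact: deriveD.
have dxD : dx (fun z => phi z + psi z) = (fun z => dx phi z + dx psi z).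
  by apply/funext => z; exact: deriveD.
split; last by move=> z; exact: cvgD (cp z) (cq z).
split; [by move=> z; exact: derivableD|by move=> z; exact: derivableD| |].
  by rewrite dtD; exact: IH.
by rewrite dxD; exact: IH.
Qed.

Lemma is_Ck2Z (R : realType) k (c : R) (phi : R * R -> R) :
  is_Ck2 k phi -> is_Ck2 k (fun z => c * phi z).
Proof.
elim: k phi => [|k IH] phi /=.
  by move=> cp z; exact: cvgMr (cp z).
move=> [[pt px pdt pdx] cp].
have dtZ : dt (fun z => c * phi z) = (fun z => c * dt phi z).
  by apply/funext => z; exact: deriveZ.
have dxZ : dx (fun z => c * phi z) = (fun z => c * dx phi z).
  by apply/funext => z; exact: deriveZ.
split; last by move=> z; exact: cvgMr (cp z).
split; [by move=> z; exact: derivableZ|by move=> z; exact: derivableZ| |].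
  by rewrite dtZ; exact: IH.
by rewrite dxZ; exact: IH.
Qed.

Lemma is_derive_line (R : realType) (phi : R * R -> R) (z v : R * R) (d : R) :
  is_derive (0 : R) (1 : R) (fun h : R => phi (h *: v + z)) d -> is_derive z v phi d.
Proof.
have E : (fun h : R => h^-1 *: (phi (h *: v + z) - phi z)) =
    (fun h : R => h^-1 *: (((fun h : R => phi (h *: v + z)) \o shift 0) (h *: 1) -
       phi (0 *: v + z))).
  by apply/funext => h /=; rewrite scale0r add0r addr0 /GRing.scale /= mulr1.
case=> dP dE; apply: DeriveDef.
  by rewrite /derivable /= E.
by rewrite /derive /= E.
Qed.

Lemma continuous_fst (R : realType) (A : R -> R) :
  continuous A -> continuous (fun z : R * R => A z.1).
Proof. by move=> cA z; apply: (@continuous_comp _ _ _ fst A); [exact: cvg_fst|exact: cA]. Qed.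

Lemma continuous_shear (R : realType) (B : R -> R) (s c : R) :
  continuous B -> continuous (fun z : R * R => B (z.2 - s * z.1 - c)).
Proof.
move=> cB z; apply: (@continuous_comp _ _ _ (fun z : R * R => z.2 - s * z.1 - c) B); last exact: cB.
apply: cvgB; last exact: cvg_cst.
apply: cvgB; first exact: cvg_snd.
by apply: cvgMr; exact: cvg_fst.
Qed.

Section product_test_function.
Context {R : realType}.
Implicit Types (A B dA dB : R -> R) (s c : R).

Lemma is_derive_prod_dt A B dA dB s c (z : R * R) :
  (forall x, is_derive x (1 : R) A (dA x)) -> (forall x, is_derive x (1 : R) B (dB x)) ->
  is_derive z (1, 0) (fun z => A z.1 * B (z.2 - s * z.1 - c))
    (dA z.1 * B (z.2 - s * z.1 - c) - s * (A z.1 * dB (z.2 - s * z.1 - c))).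
Proof.
move=> hA hB; apply: is_derive_line.
have dA' := @is_derive_affine _ A 1 z.1 0 (dA z.1).
have dB' := @is_derive_affine _ B (- s) (z.2 - s * z.1 - c) 0 (dB (z.2 - s * z.1 - c)).
rewrite !mulr0 !add0r in dA' dB'.
have -> : (fun h : R => A (h *: ((1, 0) : R * R) + z).1 *
    B ((h *: ((1, 0) : R * R) + z).2 - s * (h *: ((1, 0) : R * R) + z).1 - c)) =
    (fun h : R => A (1 * h + z.1) * B (- s * h + (z.2 - s * z.1 - c))).
  apply/funext => h /=; rewrite -[h *: 1]/(h * 1) -[h *: 0]/(h * 0).
  by congr (A _ * B _); ring.
apply: (is_derive_eq (is_deriveM (dA' (hA _)) (dB' (hB _)))).
rewrite -[X in X + _]/(_ * _) -[X in _ + X]/(_ * _) !mulr0 !add0r; ring.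
Qed.

Lemma is_derive_prod_dx A B dB s c (z : R * R) :
  (forall x, is_derive x (1 : R) B (dB x)) ->
  is_derive z (0, 1) (fun z => A z.1 * B (z.2 - s * z.1 - c))
    (A z.1 * dB (z.2 - s * z.1 - c)).
Proof.
move=> hB; apply: is_derive_line.
have dB' := @is_derive_affine _ B 1 (z.2 - s * z.1 - c) 0 (dB (z.2 - s * z.1 - c)).
rewrite !mulr0 !add0r in dB'.
have -> : (fun h : R => A (h *: ((0, 1) : R * R) + z).1 *
    B ((h *: ((0, 1) : R * R) + z).2 - s * (h *: ((0, 1) : R * R) + z).1 - c)) =
    (fun h : R => A z.1 * B (1 * h + (z.2 - s * z.1 - c))).
  apply/funext => h /=; rewrite -[h *: 1]/(h * 1) -[h *: 0]/(h * 0).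
  by congr (A _ * B _); ring.
have hc : is_derive (0 : R) (1 : R) (fun=> A z.1) 0 by exact: is_derive_cst.
apply: (is_derive_eq (is_deriveM hc (dB' (hB _)))).
by rewrite -[X in X + _]/(_ * _) -[X in _ + X]/(_ * _) mulr0 addr0 mul1r.
Qed.

Lemma is_Ck2_prod k A B s c : smooth_upto k A -> smooth_upto k B ->
  is_Ck2 k (fun z => A z.1 * B (z.2 - s * z.1 - c)).
Proof.
elim: k A B => [|k IH] A B sA sB.
  by move=> z; apply: cvgM; [exact: continuous_fst|exact: continuous_shear].
have cA : continuous A by move: sA => [dA [hA _]] x;
  apply: differentiable_continuous; apply/derivable1_diffP; case: (hA x).
have cB : continuous B by move: sB => [dB [hB _]] x;
  apply: differentiable_continuous; apply/derivable1_diffP; case: (hB x).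
have [sA' sB'] := (smooth_uptoW sA, smooth_uptoW sB).
move: sA sB => [dA [hA sA]] [dB [hB sB]].
have Et : dt (fun z => A z.1 * B (z.2 - s * z.1 - c)) =
    (fun z => dA z.1 * B (z.2 - s * z.1 - c) + (- s) * (A z.1 * dB (z.2 - s * z.1 - c))).
  by apply/funext => z; rewrite mulNr; case: (is_derive_prod_dt s c z hA hB).
have Ex : dx (fun z => A z.1 * B (z.2 - s * z.1 - c)) =
    (fun z => A z.1 * dB (z.2 - s * z.1 - c)).
  by apply/funext => z; case: (is_derive_prod_dx A s c z hB).
split; last by move=> z; apply: cvgM; [exact: continuous_fst|exact: continuous_shear].
split.
- by move=> z; case: (is_derive_prod_dt s c z hA hB).
- by move=> z; case: (is_derive_prod_dx A s c z hB).
- by rewrite Et; apply: is_Ck2D; [exact: IH|apply: is_Ck2Z; exact: IH].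
- by rewrite Ex; exact: IH.
Qed.

Lemma test_function_prod (Omega : set (R * R)) A B s c (t1 t2 x1 x2 : R) :
  (forall k, smooth_upto k A) -> (forall k, smooth_upto k B) ->
  `[t1, t2] `*` `[x1, x2] `<=` Omega ->
  (forall t x, A t * B (x - s * t - c) != 0 -> t \in `[t1, t2] /\ x \in `[x1, x2]) ->
  test_function Omega (fun z => A z.1 * B (z.2 - s * z.1 - c)).
Proof.
move=> sA sB QO suppQ; set phi := (X in test_function _ X).
have cQ : compact (`[t1, t2] `*` `[x1, x2] : set (R * R)).
  by apply: compact_setX; exact: segment_compact.
have clQ : closed (`[t1, t2] `*` `[x1, x2] : set (R * R)).
  by apply: compact_closed => //; exact: Rhausdorff.
have sub : closure [set z | phi z != 0] `<=` `[t1, t2] `*` `[x1, x2].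
  rewrite [X in _ `<=` X](closure_id _).1//; apply: closure_subset => z /suppQ [].
  by split.
split.
- by move=> k; apply: is_Ck2_prod.
- apply: (subclosed_compact _ cQ sub); exact: closed_closure.
- exact: subset_trans sub QO.
Qed.
End product_test_function.

(** * Integration over slices *)

(** Measurability refers to the product sigma-algebra, so an open set is written as the countable
    union of the rational boxes it contains. *)
Lemma open_measurable2 (R : realType) (O : set (R * R)) : open O ->
  measurable (O : set (measurableTypeR R * measurableTypeR R)).
Proof.
move=> oO.
pose rect (q : (rat * rat) * (rat * rat)) : set (R * R) :=
  `]ratr q.1.1, ratr q.1.2[ `*` `]ratr q.2.1, ratr q.2.2[.
have -> : O = \bigcup_q (if `[< rect q `<=` O >] then rect q else set0).
  apply/seteqP; split => [z Oz|z [q _]]; last by case: asboolP => // qO /qO.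
  have /nbhs_ballP[e /= e0 zeO] : nbhs z O by exact: open_nbhs_nbhs.
  have rat_lt (a b : R) : a < b -> exists r : rat, a < ratr r < b.
    move=> ab; have [r] := rat_in_itvoo ab; rewrite in_itv /= => h; by exists r.
  have [r1 /andP[r1l r1r]] : exists r : rat, z.1 - e < ratr r < z.1 by apply: rat_lt; lra.
  have [r2 /andP[r2l r2r]] : exists r : rat, z.1 < ratr r < z.1 + e by apply: rat_lt; lra.
  have [r3 /andP[r3l r3r]] : exists r : rat, z.2 - e < ratr r < z.2 by apply: rat_lt; lra.
  have [r4 /andP[r4l r4r]] : exists r : rat, z.2 < ratr r < z.2 + e by apply: rat_lt; lra.
  exists ((r1, r2), (r3, r4)) => //; rewrite ifT; last first.
    apply/asboolP => y [/=]; rewrite !in_itv /= => /andP[y1 y2] /andP[y3 y4].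
    apply: zeO; split; rewrite /ball /= ltr_norml; apply/andP; split; lra.
  by split; rewrite /= in_itv /=; apply/andP.
apply: countable_bigcupT_measurable => [|q]; first exact: countableP.
case: ifP => // _.
by apply: measurableX; exact: measurable_itv.
Qed.

Lemma continuous_measurable_fun2 (R : realType) (F : R * R -> R) : continuous F ->
  measurable_fun setT (F : measurableTypeR R * measurableTypeR R -> measurableTypeR R).
Proof.
move=> cF; apply: (measurability _ (RGenOpens.measurableE R)).
move=> _ [_ [a [b ->] <-]]; rewrite setTI; apply: open_measurable2.
by move/continuousP : cF; apply; exact: interval_open.
Qed.

Lemma measurable_box (R : realType) (a b c d : R) :
  measurable (`[a, b] `*` `[c, d] : set (measurableTypeR R * measurableTypeR R)).
Proof. by apply: measurableX; exact: measurable_itv. Qed.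

Lemma box_measure_lty (R : realType) (a b c d : R) :
  (lebesgue2 R (`[a, b] `*` `[c, d]) < +oo)%E.
Proof.
rewrite /lebesgue2 /= product_measure1E; [|exact: measurable_itv|exact: measurable_itv].
have fin (p q : R) : exists r : R, @lebesgue_measure R `[p, q]%classic = r%:E.
  by rewrite lebesgue_measure_itv; case: ifP => _; [exists (q - p)|exists 0].
by have [[r er] [r' er']] := (fin a b, fin c d); rewrite /= er er' -EFinM ltry.
Qed.

Lemma continuous_box_bounded (R : realType) (F : R * R -> R) (a b c d : R) :
  continuous F -> exists M, forall z, (`[a, b] `*` `[c, d]) z -> `|F z| <= M.
Proof.
move=> cF; have cQ : compact (`[a, b] `*` `[c, d] : set (R * R)).
  by apply: compact_setX; exact: segment_compact.
have : compact (F @` (`[a, b] `*` `[c, d])).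
  by apply: continuous_compact => //; exact: continuous_subspaceT.
move/compact_bounded => [M [_ HM]]; exists (M + 1) => z zQ.
by apply: (HM (M + 1)); [rewrite ltrDl|exists z].
Qed.

Lemma integrable_box (R : realType) (F : R * R -> R) (a b c d M : R) :
  measurable_fun setT (F : measurableTypeR R * measurableTypeR R -> measurableTypeR R) ->
  (forall z, (`[a, b] `*` `[c, d]) z -> `|F z| <= M) ->
  (forall z, ~ (`[a, b] `*` `[c, d]) z -> F z = 0) ->
  (lebesgue2 R).-integrable setT (EFin \o F).
Proof.
move=> mF bF F0; have -> : EFin \o F = (EFin \o F) \_ (`[a, b] `*` `[c, d]).
  apply/funext => z; rewrite patchE; case: ifPn => // zQ; rewrite /= F0 //.
  by move=> zQ'; move/negP: zQ; apply; exact/mem_set.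
apply/(integrable_mkcond (mu := lebesgue2 R) (EFin \o F) (measurable_box a b c d)).
apply: measurable_bounded_integrable.
- exact: measurable_box.
- exact: box_measure_lty.
- exact: measurable_funTS.
- exists M; split; first exact: num_real.
  by move=> x Mx z zQ; exact: le_trans (bF _ zQ) (ltW Mx).
Qed.

Lemma integrable_segment (R : realType) (F : R -> R) (a b M : R) :
  measurable_fun setT F -> (forall x, x \in `[a, b] -> `|F x| <= M) ->
  (@lebesgue_measure R).-integrable `[a, b] (EFin \o F).
Proof.
move=> mF bF; apply: measurable_bounded_integrable.
- exact: measurable_itv.
- by rewrite /= lebesgue_measure_itv; case: ifP => // _; rewrite -EFinB ltry.
- exact: measurable_funTS.
- exists M; split; first exact: num_real.
  by move=> x Mx z zQ; exact: le_trans (bF _ zQ) (ltW Mx).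
Qed.

(** An essential bound says nothing on a single line of constant [t], yet the later integrals in [x]
    are estimated for every [t]. Truncation gives a function bounded everywhere at the price of a
    null set. *)
Lemma Linfty_bounded_representative (R : realType) (Omega : set (R * R)) (g : R * R -> R) :
  Linfty Omega g -> exists (g1 : R * R -> R) (G : R),
  [/\ measurable_fun setT (g1 : measurableTypeR R * measurableTypeR R -> measurableTypeR R),
      measurable_fun setT (g \_ Omega : measurableTypeR R * measurableTypeR R -> measurableTypeR R),
      forall z, `|g1 z| <= G & {ae lebesgue2 R, forall z, (g \_ Omega) z = g1 z}].
Proof.
move=> gL; have mg : measurable_fun setT (g \_ Omega : measurableTypeR R * measurableTypeR R -> measurableTypeR R).
  by have := sub_Lfun_mfun gL; rewrite inE /=.
have [G gG] : exists G, {ae lebesgue2 R, forall z, `|(g \_ Omega) z| <= G}.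
  have := sub_Lfun_finLfun gL; rewrite inE /= /finite_norm unlock.
  (* The essential supremum yields a bound only over a space of positive measure; otherwise the
     whole plane is a null set and any constant will do. *)
  have [m0|m0 _] := ltP 0%E (lebesgue2 R setT).
    move=> h; have [G gG] := @ess_supr_bounded _ _ _ (lebesgue2 R) (fun z => `|(g \_ Omega) z|) h.
    by exists G.
  exists 0; exists setT; split => //.
  by apply/eqP; rewrite eq_le m0 measure_ge0.
pose g1 z := Num.max (- `|G|) (Num.min `|G| ((g \_ Omega) z)).
exists g1, `|G|; split => //.
- by apply: measurable_maxr => //; apply: measurable_minr.
- move=> z; rewrite /g1 ler_norml; apply/andP; split.
    by rewrite le_max lexx.
  by rewrite ge_max ge_min lexx andbT; have := normr_ge0 G; lra.
- case: gG => N [mN N0 sub]; exists N; split => //; apply: subset_trans sub.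
  apply: subsetC => z /= gz; rewrite /g1.
  have : `|(g \_ Omega) z| <= `|G| by rewrite (le_trans gz)// ler_norm.
  by rewrite ler_norml => /andP[h1 h2]; rewrite (min_idPr h2) (max_idPr h1).
Qed.

Lemma continuous_slice (R : realType) (F : R * R -> R) (t : R) :
  continuous F -> continuous (fun x => F (t, x)).
Proof.
move=> cF x; apply: (@continuous_comp _ _ _ (fun x => (t, x)) F); last exact: cF.
rewrite /prop_for /continuous_at.
by apply: (@cvg_pair _ _ _ (nbhs x) (nbhs t) (nbhs x)); [exact: cvg_cst|exact: cvg_id].
Qed.

Lemma continuous_slice2 (R : realType) (F : R * R -> R) (x : R) :
  continuous F -> continuous (fun t => F (t, x)).
Proof.
move=> cF t; apply: (@continuous_comp _ _ _ (fun t => (t, x)) F); last exact: cF.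
rewrite /prop_for /continuous_at.
by apply: (@cvg_pair _ _ _ (nbhs t) (nbhs t) (nbhs x)); [exact: cvg_id|exact: cvg_cst].
Qed.

Lemma continuous_Rintegral_slice (R : realType) (F : R * R -> R) (a b : R) :
  continuous F -> continuous (fun t => \int[@lebesgue_measure R]_(x in `[a, b]) F (t, x)).
Proof.
move=> cF t.
have [M HM] := continuous_box_bounded (t - 1) (t + 1) a b cF.
have tin : t \in (`]t - 1, t + 1[%classic : set R) by rewrite inE /= in_itv /=; lra.
apply: (@continuity_under_integral R _ _ (@lebesgue_measure R) (fun t x => F (t, x))
  `[a, b]%classic (measurable_itv _) (t - 1) (t + 1) _ _ (cst M) _ _ t tin).
- move=> y /=; rewrite in_itv /= => yt; apply: (@integrable_segment _ _ _ _ M).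
    by apply: continuous_measurable_fun; exact: continuous_slice.
  by move=> x xab; apply: HM; split => //=; rewrite in_itv /=; lra.
- by apply: aeW => x _ y _; exact: continuous_slice2.
- by apply: (@integrable_segment _ _ _ _ `|M|) => // x _ /=.
- move=> y /=; rewrite in_itv /= => yt; apply: aeW => x xab /=; apply: HM.
  by split => //=; rewrite in_itv /=; lra.
Qed.

(* Testing the equation with [A t * B (x - s * t - c)] and integrating in [x]
   first gives the weak form of an ordinary differential equation in [t] for the
   weighted mean of [u] along the strip of slope [s]. *)
Section slices.
Context {R : realType}.
Variables (Omega : set (R * R)) (f : R -> R) (u g g1 : R * R -> R) (G : R).
Variables (t1 t2 x1 x2 : R) (U : R * R -> R).
Hypothesis cf : continuous f.
Hypothesis cU : continuous U.
Hypothesis QO : `[t1, t2] `*` `[x1, x2] `<=` Omega.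
Hypothesis Uu : forall z, (`[t1, t2] `*` `[x1, x2]) z -> U z = u z.
Hypothesis bal : balance_law Omega f u g.
Hypothesis mg : measurable_fun setT
  (g \_ Omega : measurableTypeR R * measurableTypeR R -> measurableTypeR R).
Hypothesis mg1 : measurable_fun setT
  (g1 : measurableTypeR R * measurableTypeR R -> measurableTypeR R).
Hypothesis g1G : forall z, `|g1 z| <= G.
Hypothesis gg1 : {ae lebesgue2 R, forall z, (g \_ Omega) z = g1 z}.

Variables (A dA B dB : R -> R) (s c : R).
Hypothesis sA : forall k, smooth_upto k A.
Hypothesis sB : forall k, smooth_upto k B.
Hypothesis hA : forall x, is_derive x (1 : R) A (dA x).
Hypothesis hB : forall x, is_derive x (1 : R) B (dB x).
Hypothesis cdA : continuous dA.
Hypothesis cdB : continuous dB.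
Hypothesis suppA : forall t, t \notin `[t1, t2] -> A t = 0 /\ dA t = 0.
Hypothesis suppAB : forall t x, t \in `[t1, t2] -> A t != 0 \/ dA t != 0 ->
  x \notin `[x1, x2] -> B (x - s * t - c) = 0 /\ dB (x - s * t - c) = 0.

Let cA : continuous A. Proof. exact: (sA 0%N). Qed.
Let cB : continuous B. Proof. exact: (sB 0%N). Qed.

(** This is u dt(phi) + f(u) dx(phi) regrouped for the sheared product: the shear turns the flux f
    into the relative flux f - s id. *)
Let Psi1 z := dA z.1 * (U z * B (z.2 - s * z.1 - c)) +
  A z.1 * ((f (U z) - s * U z) * dB (z.2 - s * z.1 - c)).
Let Psi z := Psi1 z + g1 z * (A z.1 * B (z.2 - s * z.1 - c)).

Let cfU : continuous (fun z => f (U z)).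
Proof. by move=> z; apply: continuous_comp; [exact: cU|exact: cf]. Qed.

Let cPsi1 : continuous Psi1.
Proof.
move=> z; apply: cvgD; apply: cvgM.
- exact: continuous_fst.
- by apply: cvgM; [exact: cU|exact: continuous_shear].
- exact: continuous_fst.
- apply: cvgM; last exact: continuous_shear.
  by apply: cvgB; [exact: cfU|apply: cvgMr; exact: cU].
Qed.

Let cAB : continuous (fun z : R * R => A z.1 * B (z.2 - s * z.1 - c)).
Proof. by move=> z; apply: cvgM; [exact: continuous_fst|exact: continuous_shear]. Qed.

Let Psi_out (z : R * R) : ~ (`[t1, t2] `*` `[x1, x2]) z ->
  [/\ dA z.1 * B (z.2 - s * z.1 - c) = 0, A z.1 * dB (z.2 - s * z.1 - c) = 0
    & A z.1 * B (z.2 - s * z.1 - c) = 0].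
Proof.
move=> zQ; have [zt|/suppA[-> ->]] := boolP (z.1 \in `[t1, t2]); last by rewrite !mul0r.
have zx : z.2 \notin `[x1, x2] by apply/negP => zx; apply: zQ; split.
have [A0|A0] := eqVneq (A z.1) 0; have [dA0|dA0] := eqVneq (dA z.1) 0;
  rewrite ?A0 ?dA0 ?mul0r //.
- by have [-> _] := suppAB zt (or_intror dA0) zx; rewrite mulr0.
- by have [-> ->] := suppAB zt (or_introl A0) zx; rewrite !mulr0.
- by have [-> ->] := suppAB zt (or_introl A0) zx; rewrite !mulr0.
Qed.

Let Psi0 z : ~ (`[t1, t2] `*` `[x1, x2]) z -> Psi z = 0.
Proof.
move=> /Psi_out[h1 h2 h3].
have -> : Psi z = U z * (dA z.1 * B (z.2 - s * z.1 - c)) +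
    (f (U z) - s * U z) * (A z.1 * dB (z.2 - s * z.1 - c)) +
    g1 z * (A z.1 * B (z.2 - s * z.1 - c)) by rewrite /Psi /Psi1; ring.
by rewrite h1 h2 h3 !mulr0 !addr0.
Qed.

Let mPsi_with (h : R * R -> R) :
  measurable_fun setT (h : measurableTypeR R * measurableTypeR R -> measurableTypeR R) ->
  measurable_fun setT ((fun z => Psi1 z + h z * (A z.1 * B (z.2 - s * z.1 - c)))
     : measurableTypeR R * measurableTypeR R -> measurableTypeR R).
Proof.
move=> mh; apply: measurable_funD; first exact: continuous_measurable_fun2.
by apply: measurable_funM => //; exact: continuous_measurable_fun2.
Qed.

Let Psi_integrable : (lebesgue2 R).-integrable setT (EFin \o Psi).
Proof.
have [M1 HM1] := continuous_box_bounded t1 t2 x1 x2 cPsi1.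
have [M2 HM2] := continuous_box_bounded t1 t2 x1 x2 cAB.
apply: (@integrable_box _ _ t1 t2 x1 x2 (M1 + G * M2)) => //; first exact: mPsi_with.
move=> z zQ; rewrite (le_trans (ler_normD _ _))// lerD ?HM1// normrM.
by apply: ler_pM => //; exact: HM2.
Qed.

Let Psi_integral : (\int[lebesgue2 R]_z (Psi z)%:E = 0)%E.
Proof.
pose phi := fun z : R * R => A z.1 * B (z.2 - s * z.1 - c).
have tphi : test_function Omega phi.
  apply: (@test_function_prod R Omega A B s c t1 t2 x1 x2) => // t x AB0.
  apply/andP; apply/negP => /negP; rewrite negb_and => h.
  have nQ : ~ (`[t1, t2] `*` `[x1, x2]) (t, x).
    by move=> [/= h1 h2]; move: h; rewrite h1 h2.
  by have [_ _ /eqP h3] := Psi_out nQ; rewrite h3 in AB0.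
have := bal tphi; rewrite integral_mkcond => <-.
have Et z : dt phi z = dA z.1 * B (z.2 - s * z.1 - c) - s * (A z.1 * dB (z.2 - s * z.1 - c)).
  by case: (is_derive_prod_dt s c z hA hB).
have Ex z : dx phi z = A z.1 * dB (z.2 - s * z.1 - c).
  by case: (is_derive_prod_dx A s c z hB).
(* Replacing [g] by [g1] changes the integrand only on a null set. Off the box the test function and
   its derivatives vanish, and on it [U] equals [u], so the integral over [Omega] becomes that of
   [Psi] over the plane. *)
transitivity (\int[lebesgue2 R]_z (Psi1 z + (g \_ Omega) z * phi z)%:E)%E.
  apply: ae_eq_integral => //.
  - by apply/measurable_EFinP; exact: mPsi_with.
  - by apply/measurable_EFinP; exact: mPsi_with.
  - case: gg1 => N [mN N0 sub]; exists N; split => //; apply: subset_trans sub.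
    by apply: subsetC => z /= gz _; rewrite gz.
apply: eq_integral => z _; rewrite /= !patchE; case: ifPn => zO.
  congr EFin; rewrite Et Ex /phi.
  have [/Uu <-|/Psi_out[h1 h2 h3]] := pselect ((`[t1, t2] `*` `[x1, x2]) z).
    by rewrite /Psi1; ring.
  by rewrite h1 h2 h3 !mulr0 subr0 !mulr0 !addr0 /Psi1 !mulrA ![_ * U z]mulrC -!mulrA;
    rewrite h1 [A _ * (_ * _)]mulrCA h2 !mulr0 addr0.
have /Psi_out[h1 h2 h3] : ~ (`[t1, t2] `*` `[x1, x2]) z.
  by move=> /QO zO'; move/negP: zO; apply; exact/mem_set.
congr EFin; rewrite mul0r addr0 /Psi1.
by rewrite mulrCA h1 mulr0 add0r mulrCA h2 mulr0.
Qed.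

Notation mu := (@lebesgue_measure R).

Definition slice_mean (t : R) := \int[mu]_(x in `[x1, x2]) (U (t, x) * B (x - s * t - c)).

Definition slice_flux (t : R) :=
  \int[mu]_(x in `[x1, x2]) ((f (U (t, x)) - s * U (t, x)) * dB (x - s * t - c)).

Definition slice_source (t : R) := \int[mu]_(x in `[x1, x2]) (g1 (t, x) * B (x - s * t - c)).

Let cUB : continuous (fun z : R * R => U z * B (z.2 - s * z.1 - c)).
Proof. by move=> z; apply: cvgM; [exact: cU|exact: continuous_shear]. Qed.

Let cqdB : continuous (fun z : R * R => (f (U z) - s * U z) * dB (z.2 - s * z.1 - c)).
Proof.
move=> z; apply: cvgM; last exact: continuous_shear.
by apply: cvgB; [exact: cfU|apply: cvgMr; exact: cU].
Qed.

Let int_slice (F : R * R -> R) (t : R) : continuous F ->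
  mu.-integrable `[x1, x2] (EFin \o (fun x => F (t, x))).
Proof.
move=> cF; have [M HM] := continuous_box_bounded t t x1 x2 cF.
apply: (@integrable_segment _ _ _ _ M).
  by apply: continuous_measurable_fun; exact: continuous_slice.
by move=> x xx; apply: HM; split => //=; rewrite in_itv /= lexx.
Qed.

Let cBs : continuous (fun z : R * R => B (z.2 - s * z.1 - c)).
Proof. exact: continuous_shear. Qed.

Let int_source t : mu.-integrable `[x1, x2] (EFin \o (fun x => g1 (t, x) * B (x - s * t - c))).
Proof.
have [M HM] := continuous_box_bounded t t x1 x2 cBs.
apply: (@integrable_segment _ _ _ _ (G * M)).
  apply: measurable_funM; first exact: measurable_fun_pair2.
  apply: continuous_measurable_fun.
  exact: (@continuous_slice R (fun z => B (z.2 - s * z.1 - c)) t cBs).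
move=> x xx; rewrite normrM; apply: ler_pM => //.
by apply: (HM (t, x)); split => //=; rewrite in_itv /= lexx.
Qed.

Let slice_Psi t : \int[mu]_(x in `[x1, x2]) Psi (t, x) =
  dA t * slice_mean t + A t * (slice_flux t + slice_source t).
Proof.
have -> : (fun x => Psi (t, x)) = (fun x => (dA t * (U (t, x) * B (x - s * t - c)) +
   A t * ((f (U (t, x)) - s * U (t, x)) * dB (x - s * t - c))) +
   A t * (g1 (t, x) * B (x - s * t - c))).
  by apply/funext => x; rewrite /Psi /Psi1 /=; ring.
have i1 := int_slice t cUB; have i2 := int_slice t cqdB; have i3 := int_source t.
have mI : measurable (`[x1, x2]%classic : set (measurableTypeR R)) by exact: measurable_itv.
have z1 := integrableZl mI (dA t) i1; have z2 := integrableZl mI (A t) i2.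
have z3 := integrableZl mI (A t) i3.
rewrite RintegralD //; last exact: (integrableD mI z1 z2).
by rewrite RintegralD // !RintegralZl // mulrDr addrA.
Qed.

(** Fubini for the vanishing integral of [Psi]. Integrability in [t] is recorded because
    [slice_source], built from a merely measurable [g1], need not be continuous. *)
Lemma slice_identity :
  mu.-integrable `[t1, t2] (EFin \o (fun t => dA t * slice_mean t +
    A t * (slice_flux t + slice_source t))) /\
  \int[mu]_(t in `[t1, t2]) (dA t * slice_mean t + A t * (slice_flux t + slice_source t)) = 0.
Proof.
have PsiE t : (\int[mu]_x (Psi (t, x))%:E =
    (dA t * slice_mean t + A t * (slice_flux t + slice_source t))%:E)%E.
  rewrite -slice_Psi.
  have iPsi : mu.-integrable `[x1, x2] (EFin \o (fun x => Psi (t, x))).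
    have i1 := int_slice t cPsi1.
    have [M HM] := continuous_box_bounded t t x1 x2 cAB.
    have [M1 HM1] := continuous_box_bounded t t x1 x2 cPsi1.
    apply: (@integrable_segment _ _ _ _ (M1 + G * M)).
      by apply: measurable_fun_pair2; exact: mPsi_with.
    move=> x xx; have xQ : (`[t, t] `*` `[x1, x2]) (t, x).
      by split => //=; rewrite in_itv /= lexx.
    rewrite (le_trans (ler_normD _ _))// lerD ?HM1// normrM.
    by apply: ler_pM => //; exact: (HM (t, x)).
  rewrite /Rintegral fineK; last exact: integrable_fin_num.
  rewrite [RHS]integral_mkcond; apply: eq_integral => x _.
  rewrite patchE; case: ifPn => // xx; rewrite Psi0 // => -[_ /= xx'].
  by move/negP: xx; apply; rewrite inE.
have EF : fubini_F mu (EFin \o Psi) = (fun t => (dA t * slice_mean t +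
    A t * (slice_flux t + slice_source t))%:E).
  by apply/funext => t; rewrite /fubini_F /= PsiE.
have iF : mu.-integrable setT (fun t => (dA t * slice_mean t +
    A t * (slice_flux t + slice_source t))%:E).
  by rewrite -EF; exact: (integrable_fubini_F Psi_integrable).
have h : (\int[mu]_t (dA t * slice_mean t +
    A t * (slice_flux t + slice_source t))%:E = 0)%E.
  by rewrite -Psi_integral -EF; exact: (integral12_prod_meas1 Psi_integrable).
split.
  by apply: (integrableS _ _ _ iF) => //; exact: measurable_itv.
rewrite /Rintegral integral_mkcond.
rewrite (_ : (fun t => _) \_ _ = (fun t => (dA t * slice_mean t +
    A t * (slice_flux t + slice_source t))%:E)); first by rewrite h.
apply/funext => t; rewrite patchE; case: ifPn => // tt.
have tt' : t \notin `[t1, t2].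
  by apply/negP => tt'; move/negP: tt; apply; rewrite inE.
by have [-> ->] := suppA tt'; rewrite !mul0r addr0.
Qed.

Lemma continuous_slice_mean : continuous slice_mean.
Proof. exact: (@continuous_Rintegral_slice R (fun z => U z * B (z.2 - s * z.1 - c)) x1 x2 cUB). Qed.

(** Weak form of (e m)' <= K for the mean m; the pointwise bound survives the integration because
    the time cut-off [A] is nonnegative. *)
Lemma slice_ineq (e K : R) : (forall t, 0 <= A t) ->
  (forall t, t \in `[t1, t2] -> A t != 0 -> e * (slice_flux t + slice_source t) <= K) ->
  0 <= \int[mu]_(t in `[t1, t2]) (dA t * (e * slice_mean t) + A t * K).
Proof.
move=> A0 HK; have [iI I0] := slice_identity.
have mI : measurable (`[t1, t2]%classic : set (measurableTypeR R)) by exact: measurable_itv.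
rewrite -(mulr0 e) -I0 -RintegralZl //.
apply: le_Rintegral => //.
- exact: (integrableZl mI e iI).
- apply: continuous_compact_integrable; first exact: segment_compact.
  apply: continuous_subspaceT => t; apply: cvgD; apply: cvgM.
  + exact: cdA.
  + by apply: cvgMr; exact: continuous_slice_mean.
  + exact: cA.
  + exact: cvg_cst.
- move=> t /= tt; rewrite mulrDr; apply: lerD; first by rewrite mulrCA.
  have [->|An0] := eqVneq (A t) 0; first by rewrite !mul0r mulr0.
  by rewrite mulrCA; apply: ler_wpM2l => //; exact: HK.
Qed.

End slices.

(** * Plateau cut-offs and averages over their layers *)

Definition smooth_step (R : realType) : R -> R := sval (cid (exists_smooth_step R)).

Definition dsmooth_step (R : realType) : R -> R :=
  sval (cid (svalP (cid (exists_smooth_step R)))).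

Lemma smooth_stepP (R : realType) (H := @smooth_step R) (dH := @dsmooth_step R) :
  [/\ forall k, smooth_upto k H, forall x, is_derive x (1 : R) H (dH x),
      continuous dH, forall x, 0 <= dH x & [/\ forall x, x <= 0 -> H x = 0,
      forall x, 1 <= x -> H x = 1 & forall x, x \notin `[0, 1] -> dH x = 0]].
Proof. exact: svalP (cid (svalP (cid (exists_smooth_step R)))). Qed.

Section plateau.
Context {R : realType}.
Notation H := (@smooth_step R).
Notation dH := (@dsmooth_step R).

Let sH k : smooth_upto k H. Proof. by case: (smooth_stepP R). Qed.
Let hH x : is_derive x (1 : R) H (dH x). Proof. by case: (smooth_stepP R). Qed.
Let cdH : continuous dH. Proof. by case: (smooth_stepP R). Qed.
Let dH_ge0 x : 0 <= dH x. Proof. by case: (smooth_stepP R). Qed.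
Let H_le0 x : x <= 0 -> H x = 0.
Proof. by case: (smooth_stepP R) => _ _ _ _ [+ _ _]; exact. Qed.
Let H_ge1 x : 1 <= x -> H x = 1.
Proof. by case: (smooth_stepP R) => _ _ _ _ [_ + _]; exact. Qed.
Let dH_out x : x \notin `[0, 1] -> dH x = 0.
Proof. by case: (smooth_stepP R) => _ _ _ _ [_ _]; exact. Qed.
Notation mu := (@lebesgue_measure R).

(** The step H((y - a) / d), rising from 0 at a to 1 at a + d, in the affine form expected by
    [smooth_upto_affine] and [is_derive_affine]. Its derivative [bump] is a probability density on
    [a, a + d]. *)
Definition ramp (a d y : R) := H (d^-1 * y + (- a / d)).
Definition bump (a d y : R) := d^-1 * dH (d^-1 * y + (- a / d)).
(* A smooth approximation of the indicator function of [[a, b]], with transition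
   layers of width [d] inside the interval. *)
Definition plateau (a b d y : R) := ramp a d y + (- 1) * ramp (b - d) d y.
Definition dplateau (a b d y : R) := bump a d y + (- 1) * bump (b - d) d y.

Lemma ramp_argE (a d y : R) : d^-1 * y + (- a / d) = (y - a) / d.
Proof. by rewrite mulrC -mulrDl. Qed.

Let H_homo : {homo H : x y / x <= y}.
Proof.
move=> x y xy; have [] := @MVT_segment R H dH x y xy.
- by move=> z _; exact: hH.
- by apply: continuous_subspaceT; exact: (sH 0%N).
by move=> z _ E; rewrite -subr_ge0 E mulr_ge0 // subr_ge0.
Qed.

Let H_itv x : 0 <= H x <= 1.
Proof.
apply/andP; split.
  have [x0|x0] := leP x 0; first by rewrite H_le0.
  by rewrite -(H_le0 (lexx 0)); apply: H_homo; exact: ltW.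
have [x1|x1] := leP 1 x; first by rewrite H_ge1.
by rewrite -(H_ge1 (lexx 1)); apply: H_homo; exact: ltW.
Qed.

Lemma smooth_ramp k (a d : R) : smooth_upto k (ramp a d).
Proof. exact: smooth_upto_affine. Qed.

Lemma is_derive_ramp (a d y : R) : is_derive y (1 : R) (ramp a d) (bump a d y).
Proof. exact: is_derive_affine. Qed.

Lemma smooth_plateau k (a b d : R) : smooth_upto k (plateau a b d).
Proof.
apply: smooth_uptoD; first exact: smooth_ramp.
by apply: smooth_uptoM (smooth_upto_cst _ _) _; exact: smooth_ramp.
Qed.

Lemma is_derive_plateau (a b d y : R) :
  is_derive y (1 : R) (plateau a b d) (dplateau a b d y).
Proof.
apply: is_deriveD; first exact: is_derive_ramp.
exact: (@is_deriveZ _ _ _ _ (-1) y 1 _ (is_derive_ramp (b - d) d y)).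
Qed.

Lemma continuous_bump (a d : R) : continuous (bump a d).
Proof.
move=> y; apply: cvgMr.
apply: (@continuous_comp _ _ _ (fun y => d^-1 * y + (- a / d))); last exact: cdH.
by apply: cvgD; [apply: cvgMr; exact: cvg_id|exact: cvg_cst].
Qed.

Lemma continuous_dplateau (a b d : R) : continuous (dplateau a b d).
Proof.
by move=> y; apply: cvgD; [exact: continuous_bump|apply: cvgMr; exact: continuous_bump].
Qed.

Lemma bump_ge0 (a d y : R) : 0 < d -> 0 <= bump a d y.
Proof. by move=> d0; rewrite mulr_ge0 // invr_ge0 ltW. Qed.

Lemma bump_out (a d y : R) : 0 < d -> y \notin `[a, a + d] -> bump a d y = 0.
Proof.
move=> d0; rewrite in_itv /= => yn; rewrite /bump dH_out ?mulr0 // ramp_argE in_itv /=.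
by rewrite pmulr_lge0 ?invr_gt0 // ler_pdivrMr // mul1r subr_ge0 lerBlDl.
Qed.

Lemma ramp_le (a d y : R) : 0 < d -> y <= a -> ramp a d y = 0.
Proof.
move=> d0 ya; rewrite /ramp ramp_argE H_le0 // pmulr_lle0 ?invr_gt0 // subr_le0 //.
Qed.

Lemma ramp_ge (a d y : R) : 0 < d -> a + d <= y -> ramp a d y = 1.
Proof.
by move=> d0 ya; rewrite /ramp ramp_argE H_ge1 // ler_pdivlMr // mul1r; lra.
Qed.

Lemma plateau_out (a b d y : R) : 0 < d -> a + d <= b -> y \notin `[a, b] ->
  plateau a b d y = 0 /\ dplateau a b d y = 0.
Proof.
move=> d0 ab; rewrite in_itv /= negb_and -!ltNge => /orP yab.
have out1 : y \notin `[a, a + d] by rewrite in_itv /= negb_and -!ltNge; apply/orP; lra.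
have out2 : y \notin `[b - d, b - d + d].
  by rewrite in_itv /= negb_and -!ltNge; apply/orP; lra.
rewrite /dplateau !bump_out // mulr0 addr0; split => //.
rewrite /plateau; case: yab => h; first by rewrite !ramp_le ?mulr0 ?addr0 //; lra.
by rewrite !ramp_ge // ?mulr1 ?subrr //; lra.
Qed.

Lemma plateau_itv (a b d y : R) : 0 < d -> a + d <= b -> 0 <= plateau a b d y <= 1.
Proof.
move=> d0 ab; rewrite /plateau.
have h : ramp (b - d) d y <= ramp a d y.
  apply: H_homo; rewrite !ramp_argE ler_pM2r ?invr_gt0 //; lra.
have /andP[h1 h2] : 0 <= ramp (b - d) d y <= 1 by exact: H_itv.
have /andP[h3 h4] : 0 <= ramp a d y <= 1 by exact: H_itv.
lra.
Qed.

Lemma plateau_eq1 (a b d y : R) : 0 < d -> a + d <= y -> y <= b - d ->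
  plateau a b d y = 1.
Proof.
by move=> d0 ay yb; rewrite /plateau ramp_ge // ramp_le // mulr0 addr0.
Qed.

Lemma integral_bump (a d y p q : R) : 0 < d -> p <= y + a -> y + a + d <= q ->
  \int[mu]_(x in `[p, q]) bump a d (x - y) = 1.
Proof.
move=> d0 pa aq; have pq : p < q by lra.
have hr x : is_derive x (1 : R) (fun x => ramp a d (x - y)) (bump a d (x - y)).
  have := @is_derive_affine R (ramp a d) 1 (- y) x (bump a d (1 * x + - y)) (is_derive_ramp _ _ _).
  rewrite !mul1r; have -> // : (fun x => ramp a d (1 * x - y)) = (fun x => ramp a d (x - y)).
  by apply/funext => z; rewrite mul1r.
have cr : continuous (fun x => ramp a d (x - y)).
  by move=> x; apply: differentiable_continuous; apply/derivable1_diffP; case: (hr x).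
rewrite /Rintegral (@continuous_FTC2 R _ (fun x => ramp a d (x - y)) p q pq).
- by rewrite ramp_ge ?ramp_le ?sube0 //=; lra.
- apply: continuous_subspaceT => x.
  apply: (@continuous_comp _ _ _ (fun x => x - y)); last exact: continuous_bump.
  by apply: cvgB; [exact: cvg_id|exact: cvg_cst].
- split.
  + by move=> x _; case: (hr x).
  + by apply: cvg_at_right_filter; exact: cr.
  + by apply: cvg_at_left_filter; exact: cr.
- by move=> x _; rewrite derive1E; case: (hr x).
Qed.

Lemma bump_integrable (a d y p q : R) :
  mu.-integrable `[p, q] (EFin \o (fun x => bump a d (x - y))).
Proof.
apply: continuous_compact_integrable; first exact: segment_compact.
apply: continuous_subspaceT => x.
apply: (@continuous_comp _ _ _ (fun x => x - y)); last exact: continuous_bump.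
by apply: cvgB; [exact: cvg_id|exact: cvg_cst].
Qed.

Lemma bump_mul_integrable (F : R -> R) (a d y p q : R) : continuous F ->
  mu.-integrable `[p, q] (EFin \o (fun x => F x * bump a d (x - y))).
Proof.
move=> cF; apply: continuous_compact_integrable; first exact: segment_compact.
apply: continuous_subspaceT => x; apply: cvgM; first exact: cF.
apply: (@continuous_comp _ _ _ (fun x => x - y)); last exact: continuous_bump.
by apply: cvgB; [exact: cvg_id|exact: cvg_cst].
Qed.

(** [bump] is nonnegative, of mass 1 and lives on a layer of width [d], so the integral is an
    average of [F] over that layer. *)
Lemma bump_mean_le (F : R -> R) (a d y p q M : R) : 0 < d -> continuous F ->
  p <= y + a -> y + a + d <= q ->
  (forall x, x \in `[y + a, y + a + d] -> F x <= M) ->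
  \int[mu]_(x in `[p, q]) (F x * bump a d (x - y)) <= M.
Proof.
move=> d0 cF pa aq FM; rewrite -[leRHS]mulr1 -(integral_bump d0 pa aq).
have mI : measurable (`[p, q]%classic : set (measurableTypeR R)) by exact: measurable_itv.
have iB := bump_integrable a d y p q.
rewrite -RintegralZl //; apply: le_Rintegral => //.
- exact: bump_mul_integrable.
- exact: (integrableZl mI M iB).
- move=> x _; have [xa|xa] := boolP (x \in `[y + a, y + a + d]).
    by apply: ler_wpM2r; [exact: bump_ge0|exact: FM].
  rewrite bump_out ?mulr0 //; apply: contra xa; rewrite !in_itv /=; lra.
Qed.

Lemma bump_mean_ge (F : R -> R) (a d y p q M : R) : 0 < d -> continuous F ->
  p <= y + a -> y + a + d <= q ->
  (forall x, x \in `[y + a, y + a + d] -> M <= F x) ->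
  M <= \int[mu]_(x in `[p, q]) (F x * bump a d (x - y)).
Proof.
move=> d0 cF pa aq FM.
have cN : continuous (fun x => - F x) by move=> x; apply: cvgN; exact: cF.
have := @bump_mean_le (fun x => - F x) a d y p q (- M) d0 cN pa aq.
have -> : \int[mu]_(x in `[p, q]) (- F x * bump a d (x - y)) =
    - \int[mu]_(x in `[p, q]) (F x * bump a d (x - y)).
  rewrite -[RHS]mulN1r -RintegralZl //; last exact: bump_mul_integrable.
  by apply: eq_Rintegral => x _; rewrite mulN1r mulNr.
rewrite lerN2; apply => x xa; rewrite lerN2; exact: FM.
Qed.

Definition plateau_mass (a b d : R) := \int[mu]_(x in `[a, b]) plateau a b d x.

Lemma integral_plateau (a b d y p q : R) : 0 < d -> a + d <= b ->
  p <= y + a -> y + b <= q ->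
  \int[mu]_(x in `[p, q]) plateau a b d (x - y) = plateau_mass a b d.
Proof.
move=> d0 ab pa bq; rewrite /plateau_mass /Rintegral; congr fine.
transitivity (\int[mu]_(x in `[(a + y)%R, (b + y)%R]) (plateau a b d (x - y))%:E)%E.
  have out (x : R) : x \notin `[a + y, b + y] -> plateau a b d (x - y) = 0.
    move=> xn; have [] // := @plateau_out a b d (x - y) d0 ab.
    by apply: contra xn; rewrite !in_itv /=; lra.
  have sub (x : R) : x \in `[a + y, b + y] -> x \in `[p, q] by rewrite !in_itv /=; lra.
  rewrite integral_mkcond [RHS]integral_mkcond; apply: eq_integral => x _.
  rewrite !patchE; case: ifPn => xpq; case: ifPn => xab //.
    by rewrite out //; apply: contra xab; rewrite inE.
  by exfalso; move/negP: xpq; apply; move: xab; rewrite !inE; exact: sub.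
have idP x : is_derive x (1 : R) (fun x : R => x + y) 1.
  by apply: is_derive_eq; rewrite addr0.
have dE : (fun x : R => x + y)^`()%classic = cst 1.
  by apply/funext => x; rewrite derive1E; case: (idP x).
have cadd : continuous (fun x : R => x + y).
  by move=> x; apply: cvgD; [exact: cvg_id|exact: cvg_cst].
rewrite (@integration_by_substitution_increasing R (fun x => x + y)
  (fun x => plateau a b d (x - y)) a b).
- apply: eq_integral => x _ /=; congr EFin.
  by rewrite dE -[LHS]/(plateau a b d (x + y - y) * 1) mulr1 addrK.
- by lra.
- by move=> x z _ _ xz; rewrite ltrD2r.
- by rewrite dE => x _; exact: cvg_cst.
- by rewrite dE; exact: is_cvg_cst.
- by rewrite dE; exact: is_cvg_cst.
- split.
  + by move=> x _; case: (idP x).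
  + by apply: cvg_at_right_filter; exact: cadd.
  + by apply: cvg_at_left_filter; exact: cadd.
- apply: continuous_subspaceT => x.
  apply: (@continuous_comp _ _ _ (fun x => x - y)); last exact: (smooth_plateau 0%N).
  by apply: cvgB; [exact: cvg_id|exact: cvg_cst].
Qed.

Lemma plateau_mass_bounds (a b d : R) : 0 < d -> a + d <= b ->
  b - a - 2 * d <= plateau_mass a b d <= b - a.
Proof.
move=> d0 ab; have cP : continuous (plateau a b d) by exact: (smooth_plateau 0%N).
have iP (p q : R) : mu.-integrable `[p, q] (EFin \o plateau a b d).
  apply: continuous_compact_integrable; first exact: segment_compact.
  exact: continuous_subspaceT.
have i1 (p q : R) : mu.-integrable `[p, q] (EFin \o (fun=> 1 : R)).
  apply: continuous_compact_integrable; first exact: segment_compact.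
  by apply: continuous_subspaceT => x; exact: cvg_cst.
have I1 (p q : R) : p <= q -> \int[mu]_(x in `[p, q]) (1 : R) = q - p.
  move=> pq; rewrite Rintegral_cst // mul1r /= lebesgue_measure_itv /= lte_fin.
  by case: ltgtP pq => // -> _; rewrite subrr.
have patchI (F : R -> R) (p q : R) : mu.-integrable `[p, q] (EFin \o F) ->
    mu.-integrable setT (EFin \o F \_ `[p, q]).
  move=> iF; rewrite -restrict_EFin.
  exact/(integrable_mkcond (mu := mu) (EFin \o F) (measurable_itv _)).
apply/andP; split; last first.
  rewrite -I1; last lra.
  by apply: le_Rintegral => // x _; case/andP: (plateau_itv x d0 ab).
have [dab|dab] := leP (a + d) (b - d); last first.
  apply: (@le_trans _ _ 0); first lra.
  by apply: Rintegral_ge0 => x _; case/andP: (plateau_itv x d0 ab).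
have -> : b - a - 2 * d = (b - d) - (a + d) by ring.
rewrite -I1 // /plateau_mass [leLHS]Rintegral_mkcond [leRHS]Rintegral_mkcond.
apply: le_Rintegral => //.
- exact: patchI.
- exact: patchI.
have in1 (x : R) : x \in `[a + d, b - d] -> plateau a b d x = 1.
  by rewrite in_itv /= => xab; rewrite plateau_eq1 //; lra.
have sub (x : R) : x \in `[a + d, b - d] -> x \in `[a, b] by rewrite !in_itv /=; lra.
move=> x _; rewrite !patchE; case: ifPn => xab; case: ifPn => xab' //.
- by rewrite in1 //; move: xab; rewrite inE.
- by exfalso; move/negP: xab'; apply; move: xab; rewrite !inE; exact: sub.
- by case/andP: (plateau_itv x d0 ab).
Qed.

End plateau.

(** * Evolution of means over strips *)

Section strip.
Context {R : realType}.
Notation mu := (@lebesgue_measure R).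
Variables (X1 X2 : R) (U : R * R -> R).
Hypothesis cU : continuous U.

(** It involves the position [y] at time [t] but no slope, so pieces of a polygon with different
    slopes can share it. The division by the mass is postponed to the comparison with [U]. *)
Definition strip_mean (al be d t y : R) :=
  \int[mu]_(x in `[X1, X2]) (U (t, x) * plateau al be d (x - y)).

Let continuous_plateau_shift (al be d y : R) : continuous (fun x => plateau al be d (x - y)).
Proof.
move=> x; apply: (@continuous_comp _ _ _ (fun x => x - y)).
  by apply: cvgB; [exact: cvg_id|exact: cvg_cst].
exact: (smooth_plateau 0%N).
Qed.

Let int_continuous (F : R -> R) : continuous F -> mu.-integrable `[X1, X2] (EFin \o F).
Proof.
move=> cF; apply: continuous_compact_integrable; first exact: segment_compact.
exact: continuous_subspaceT.
Qed.

Lemma strip_mean_close (al be d t y v k : R) : 0 < d -> al + d <= be ->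
  X1 <= y + al -> y + be <= X2 ->
  (forall x, x \in `[y + al, y + be] -> `|U (t, x) - v| <= k) ->
  `|strip_mean al be d t y - v * plateau_mass al be d| <= k * plateau_mass al be d.
Proof.
move=> d0 albe yal ybe Uv.
have mI : measurable (`[X1, X2]%classic : set (measurableTypeR R)) by exact: measurable_itv.
have cP := @continuous_plateau_shift al be d y.
have cUP : continuous (fun x => U (t, x) * plateau al be d (x - y)).
  by move=> x; apply: cvgM; [exact: continuous_slice|exact: cP].
rewrite -(integral_plateau d0 albe yal ybe) -!RintegralZl ?int_continuous //.
rewrite /strip_mean -RintegralB //; try exact: int_continuous; last first.
  by apply: int_continuous => x; apply: cvgMr; exact: cP.
apply: (le_trans (le_normr_Rintegral _ _)) => //.
  by apply: int_continuous => x; apply: cvgB; [exact: cUP|apply: cvgMr; exact: cP].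
apply: le_Rintegral => //.
- apply: int_continuous => x; apply: cvg_norm.
  by apply: cvgB; [exact: cUP|apply: cvgMr; exact: cP].
- by apply: int_continuous => x; apply: cvgMr; exact: cP.
move=> x _; rewrite -mulrBl normrM; case/andP: (plateau_itv (x - y) d0 albe) => P0 _.
rewrite [X in _ * X <= _]ger0_norm //.
have [xin|xout] := boolP (x \in `[y + al, y + be]).
  by apply: ler_wpM2r => //; exact: Uv.
have [|-> _] := @plateau_out R al be d (x - y) d0 albe; last by rewrite !mulr0.
by apply: contra xout; rewrite !in_itv /=; lra.
Qed.

Variables (Omega : set (R * R)) (f : R -> R) (u g g1 : R * R -> R) (G T1 T2 : R).
Hypothesis cf : continuous f.
Hypothesis QO : `[T1, T2] `*` `[X1, X2] `<=` Omega.
Hypothesis Uu : forall z, (`[T1, T2] `*` `[X1, X2]) z -> U z = u z.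
Hypothesis bal : balance_law Omega f u g.
Hypothesis mg : measurable_fun setT
  (g \_ Omega : measurableTypeR R * measurableTypeR R -> measurableTypeR R).
Hypothesis mg1 : measurable_fun setT
  (g1 : measurableTypeR R * measurableTypeR R -> measurableTypeR R).
Hypothesis g1G : forall z, `|g1 z| <= G.
Hypothesis gg1 : {ae lebesgue2 R, forall z, (g \_ Omega) z = g1 z}.

Let slice_source_le (al be d s c t e : R) : `|e| = 1 -> 0 < d -> al + d <= be ->
  X1 <= s * t + c + al -> s * t + c + be <= X2 ->
  e * slice_source g1 X1 X2 (plateau al be d) s c t <= G * plateau_mass al be d.
Proof.
move=> e1 d0 albe yal ybe.
have mI : measurable (`[X1, X2]%classic : set (measurableTypeR R)) by exact: measurable_itv.
have cP := @continuous_plateau_shift al be d (s * t + c).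
have iS : mu.-integrable `[X1, X2] (EFin \o (fun x => g1 (t, x) * plateau al be d (x - (s * t + c)))).
  apply: (@integrable_segment _ _ _ _ G).
    apply: measurable_funM; first exact: measurable_fun_pair2.
    exact: continuous_measurable_fun.
  move=> x _; case/andP: (plateau_itv (x - (s * t + c)) d0 albe) => P0 P1.
  by rewrite normrM (ger0_norm P0) -[leRHS]mulr1; apply: ler_pM.
have -> : slice_source g1 X1 X2 (plateau al be d) s c t =
    \int[mu]_(x in `[X1, X2]) (g1 (t, x) * plateau al be d (x - (s * t + c))).
  by apply: eq_Rintegral => x _; rewrite opprD addrA.
rewrite -(integral_plateau d0 albe yal ybe) -RintegralZl // -RintegralZl //; last exact: int_continuous.
apply: le_Rintegral => //.
- exact: (integrableZl mI e iS).
- by apply: int_continuous => x; apply: cvgMr; exact: cP.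
move=> x _; rewrite mulrA; case/andP: (plateau_itv (x - (s * t + c)) d0 albe) => P0 _.
by apply: ler_wpM2r => //; rewrite (le_trans (ler_norm _)) // normrM e1 mul1r.
Qed.

(** The derivative of a plateau is a probability density on the left layer minus one on the right
    layer, so the flux is a difference of two averages of the relative flux. *)
Let slice_flux_le (al be d s c t e M1 M2 : R) : 0 < d -> al + d <= be ->
  X1 <= s * t + c + al -> s * t + c + be <= X2 ->
  (forall x, x \in `[s * t + c + al, s * t + c + al + d] ->
    e * (f (U (t, x)) - s * U (t, x)) <= M1) ->
  (forall x, x \in `[s * t + c + (be - d), s * t + c + (be - d) + d] ->
    M2 <= e * (f (U (t, x)) - s * U (t, x))) ->
  e * slice_flux f X1 X2 U (dplateau al be d) s c t <= M1 - M2.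
Proof.
move=> d0 albe yal ybe q1 q2.
have mI : measurable (`[X1, X2]%classic : set (measurableTypeR R)) by exact: measurable_itv.
have cUt : continuous (fun x => U (t, x)) by exact: continuous_slice.
have cq : continuous (fun x => e * (f (U (t, x)) - s * U (t, x))).
  move=> x; apply: cvgMr; apply: cvgB; last by apply: cvgMr; exact: cUt.
  by apply: (@continuous_comp _ _ _ (fun x => U (t, x))); [exact: cUt|exact: cf].
have i1 := bump_mul_integrable al d (s * t + c) X1 X2 cq.
have i2 := bump_mul_integrable (be - d) d (s * t + c) X1 X2 cq.
have -> : e * slice_flux f X1 X2 U (dplateau al be d) s c t =
  \int[mu]_(x in `[X1, X2]) (e * (f (U (t, x)) - s * U (t, x)) * bump al d (x - (s * t + c))) -
  \int[mu]_(x in `[X1, X2]) (e * (f (U (t, x)) - s * U (t, x)) * bump (be - d) d (x - (s * t + c))).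
  rewrite -RintegralB // -RintegralZl //.
    by apply: eq_Rintegral => x _; rewrite /dplateau opprD addrA mulN1r mulrA mulrBr.
  apply: int_continuous => x; apply: cvgM.
    apply: cvgB; last by apply: cvgMr; exact: cUt.
    by apply: (@continuous_comp _ _ _ (fun x => U (t, x))); [exact: cUt|exact: cf].
  apply: (@continuous_comp _ _ _ (fun x => x - s * t - c)); last exact: continuous_dplateau.
  by apply: cvgB; [apply: cvgB; [exact: cvg_id|exact: cvg_cst]|exact: cvg_cst].
apply: lerB.
  by apply: bump_mean_le => //; lra.
by apply: bump_mean_ge => //; lra.
Qed.

(* [A] is a plateau whose layers shrink to the endpoints of [[a, b]]; this makes
   the weak inequality of [slice_ineq] sharp in time. *)
Lemma strip_evolution (al be d s y a b e K M1 M2 : R) : `|e| = 1 ->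
  T1 <= a -> a < b -> b <= T2 -> 0 < d -> al + d <= be ->
  (forall t, t \in `[a, b] ->
    X1 <= y + s * (t - a) + al /\ y + s * (t - a) + be <= X2) ->
  (forall t x, t \in `[a, b] -> x \in `[y + s * (t - a) + al, y + s * (t - a) + al + d] ->
    e * (f (U (t, x)) - s * U (t, x)) <= M1) ->
  (forall t x, t \in `[a, b] -> x \in `[y + s * (t - a) + be - d, y + s * (t - a) + be] ->
    M2 <= e * (f (U (t, x)) - s * U (t, x))) ->
  0 <= K -> M1 - M2 + G * plateau_mass al be d <= K ->
  e * (strip_mean al be d b (y + s * (b - a)) - strip_mean al be d a y) <= K * (b - a).
Proof.
move=> e1 aT1 ab bT2 d0 albe inX q1 q2 K0 MK.
have [c yE] : exists c, forall t, s * t + c = y + s * (t - a).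
  by exists (y - s * a) => t; ring.
pose m t := slice_mean X1 X2 U (plateau al be d) s c t.
have mE t : m t = strip_mean al be d t (y + s * (t - a)).
  rewrite -yE /m /slice_mean /strip_mean; apply: eq_Rintegral => x _.
  by congr (_ * plateau _ _ _ _); rewrite opprD addrA.
have -> : strip_mean al be d a y = m a by rewrite mE subrr mulr0 addr0.
rewrite -mE.
have sP k : smooth_upto k (plateau al be d) by exact: smooth_plateau.
have cm : continuous m by exact: continuous_slice_mean.
have cem : continuous (fun t => e * m t) by move=> t; apply: cvgMr; exact: cm.
have QabO : `[a, b] `*` `[X1, X2] `<=` Omega.
  apply: subset_trans QO => z [/= z1 z2]; split => //=.
  by move: z1; rewrite !in_itv /=; lra.
have Uabu z : (`[a, b] `*` `[X1, X2]) z -> U z = u z.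
  move=> [/= z1 z2]; apply: Uu; split => //=.
  by move: z1; rewrite !in_itv /=; lra.
have fluxK t : t \in `[a, b] -> e * (slice_flux f X1 X2 U (dplateau al be d) s c t +
    slice_source g1 X1 X2 (plateau al be d) s c t) <= K.
  move=> tab; have [h1 h2] := inX t tab; rewrite -yE in h1 h2.
  rewrite mulrDr (le_trans _ MK) // lerD //.
    apply: slice_flux_le => //.
      by move=> x; rewrite yE; exact: q1.
    move=> x; rewrite yE => xx; apply: q2 => //; move: xx; rewrite !in_itv /=; lra.
  exact: slice_source_le.
apply/ler_addgt0Pr => k k0.
have k2 : 0 < k / 2 by lra.
have near_a : \forall t \near a, `|e * m a - e * m t| < k / 2.
  by move/cvgrPdist_lt : (cem a); apply.
have near_b : \forall t \near b, `|e * m b - e * m t| < k / 2.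
  by move/cvgrPdist_lt : (cem b); apply.
move/nbhs_ballP: near_a => [r1 /= r10 Hr1]; move/nbhs_ballP: near_b => [r2 /= r20 Hr2].
(* The layers of the time cut-off are so short that [e * m] varies by less than k/2 on each. The
   averages over them may then be replaced by the values at [a] and [b], at a total cost [k]. *)
pose n := Num.min (Num.min (r1 / 2) (r2 / 2)) ((b - a) / 2).
have n0 : 0 < n by rewrite !lt_min; apply/andP; split; [apply/andP; split|]; lra.
have nr1 : n < r1.
  have : n <= r1 / 2 by rewrite !ge_min lexx.
  lra.
have nr2 : n < r2.
  have : n <= r2 / 2 by rewrite !ge_min lexx orbT.
  lra.
have nab : n <= (b - a) / 2 by rewrite !ge_min lexx orbT.
have cA : continuous (plateau a b n) by exact: (smooth_plateau 0%N).
have anb : a + n <= b by lra.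
have := @slice_ineq R Omega f u g g1 G a b X1 X2 U cf cU QabO Uabu bal mg mg1 g1G gg1
  (plateau a b n) (dplateau a b n) (plateau al be d) (dplateau al be d) s c
  (fun k => smooth_plateau k a b n) sP (is_derive_plateau a b n) (is_derive_plateau al be d)
  (@continuous_dplateau R a b n) (@continuous_dplateau R al be d)
  (fun t => @plateau_out R a b n t n0 anb).
have outP t x : t \in `[a, b] -> plateau a b n t != 0 \/ dplateau a b n t != 0 ->
    x \notin `[X1, X2] -> plateau al be d (x - s * t - c) = 0 /\
    dplateau al be d (x - s * t - c) = 0.
  move=> tab _ xX; apply: plateau_out => //; apply: contra xX.
  have [] := inX t tab; rewrite -yE !in_itv /=; lra.
move=> /(_ outP e K (fun t => (andP (plateau_itv t n0 anb)).1) (fun t tab _ => fluxK t tab)).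
have mI : measurable (`[a, b]%classic : set (measurableTypeR R)) by exact: measurable_itv.
have i1 := bump_mul_integrable a n 0 a b cem.
have i2 := bump_mul_integrable (b - n) n 0 a b cem.
have i3 : mu.-integrable `[a, b] (EFin \o plateau a b n).
  apply: continuous_compact_integrable; first exact: segment_compact.
  exact: continuous_subspaceT.
have i3K := integrableZl mI K i3.
have -> : \int[mu]_(t in `[a, b]) (dplateau a b n t *
    (e * slice_mean X1 X2 U (plateau al be d) s c t) + plateau a b n t * K) =
  \int[mu]_(t in `[a, b]) (e * m t * bump a n (t - 0)) -
  \int[mu]_(t in `[a, b]) (e * m t * bump (b - n) n (t - 0)) + K * plateau_mass a b n.
  rewrite -RintegralB // -RintegralZl // -RintegralD //; last exact: (integrableB mI i1 i2).
  by apply: eq_Rintegral => t _; rewrite /dplateau /m subr0; ring.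
have b1 : \int[mu]_(t in `[a, b]) (e * m t * bump a n (t - 0)) <= e * m a + k / 2.
  apply: bump_mean_le => //; [lra|lra|] => t; rewrite in_itv /= => tt.
  have : `|e * m a - e * m t| < k / 2.
    by apply: Hr1; rewrite /ball /= ltr_norml; lra.
  rewrite ltr_norml; lra.
have b2 : e * m b - k / 2 <= \int[mu]_(t in `[a, b]) (e * m t * bump (b - n) n (t - 0)).
  apply: bump_mean_ge => //; [lra|lra|] => t; rewrite in_itv /= => tt.
  have : `|e * m b - e * m t| < k / 2.
    by apply: Hr2; rewrite /ball /= ltr_norml; lra.
  rewrite ltr_norml; lra.
have /andP[_ b3] := plateau_mass_bounds n0 anb.
(* The mass of the time cut-off is replaced by its upper bound b - a, hence the condition
   [0 <= K]. *)
have b4 := ler_wpM2l K0 b3.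
rewrite mulrBr; lra.
Qed.

End strip.

(** * Characteristics *)

Lemma sqr1_cases (R : realType) (x : R) : x ^+ 2 = 1 -> x = 1 \/ x = - 1.
Proof. by move/eqP; rewrite sqrf_eq1 => /orP[/eqP|/eqP]; [left|right]. Qed.

(** By the mean value theorem the remainder is (F x - F v)(w - v) with x between v and w, and both
    factors have the same sign where [F] increases: a convex or concave [f] lies on one side of its
    tangent. *)
Lemma tangent_ge0 (R : realType) (f F : R -> R) (sg zl zh v w : R) :
  (forall x, is_derive x (1 : R) f (F x)) ->
  (forall x y, zl <= x -> x <= y -> y <= zh -> 0 <= sg * (F y - F x)) ->
  zl <= v <= zh -> zl <= w <= zh -> 0 <= sg * (f w - f v - F v * (w - v)).
Proof.
move=> hf mF /andP[v1 v2] /andP[w1 w2].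
have cf x y : {within `[x, y], continuous f}.
  apply: continuous_subspaceT => z; apply: differentiable_continuous.
  by apply/derivable1_diffP; case: (hf z).
have [vw|wv] := leP v w.
  have [x] := MVT_segment vw (fun x _ => hf x) (cf v w).
  rewrite in_itv /= => /andP[vx xw] ->.
  have -> : sg * (F x * (w - v) - F v * (w - v)) = sg * (F x - F v) * (w - v) by ring.
  by rewrite mulr_ge0 ?subr_ge0 // mF //; lra.
have [x] := MVT_segment (ltW wv) (fun x _ => hf x) (cf w v).
rewrite in_itv /= => /andP[wx xv] E.
have -> : sg * (f w - f v - F v * (w - v)) = sg * (F v * (v - w) - (f v - f w)) by ring.
rewrite E; have -> : sg * (F v * (v - w) - F x * (v - w)) = sg * (F v - F x) * (v - w) by ring.
by rewrite mulr_ge0 ?subr_ge0 ?(ltW wv) // mF //; lra.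
Qed.

(** Serves at the inner edge of a strip, where the relative flux must be close to its extremal
    value: the error is controlled by the oscillation of [U], uniformly in the base point. *)
Lemma tangent_lipschitz (R : realType) (f F : R -> R) (S vl vh v w : R) :
  (forall x, is_derive x (1 : R) f (F x)) ->
  (forall x, vl <= x <= vh -> `|F x| <= S) ->
  vl <= v <= vh -> vl <= w <= vh -> `|f w - f v - F v * (w - v)| <= 2 * S * `|w - v|.
Proof.
move=> hf bF vv ww.
have cf x y : {within `[x, y], continuous f}.
  apply: continuous_subspaceT => z; apply: differentiable_continuous.
  by apply/derivable1_diffP; case: (hf z).
have [x [xl xh E]] : exists x, [/\ vl <= x, x <= vh & f w - f v = F x * (w - v)].
  have [vw|wv] := leP v w.
    have [x] := MVT_segment vw (fun x _ => hf x) (cf v w).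
    by rewrite in_itv /= => ? ->; exists x; split => //; lra.
  have [x] := MVT_segment (ltW wv) (fun x _ => hf x) (cf w v).
  rewrite in_itv /= => xx E; exists x; split; [lra|lra|].
  by rewrite -[LHS]opprB E; ring.
rewrite E -mulrBl normrM; apply: ler_wpM2r => //.
rewrite (le_trans (ler_normB _ _)) //.
have := bF x; have := bF v vv; rewrite xl xh => h1 /(_ isT) h2; lra.
Qed.

(* The only consequences of the equation that are used below: [U] is [u] extended
   continuously to the plane, [F] is the derivative of [f] and [lb_strip] is the
   conclusion of [strip_evolution]. *)
Record local_balance (R : realType) (f F : R -> R) (U : R * R -> R)
    (G T1 T2 X1 X2 S vl vh : R) : Prop := LocalBalance {
  lb_continuous : continuous U;
  lb_derive : forall x, is_derive x (1 : R) f (F x);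
  lb_speed : forall x, vl <= x <= vh -> `|F x| <= S;
  lb_range : forall z, vl <= U z <= vh;
  lb_unif : forall k, 0 < k -> exists2 d, 0 < d &
    forall t t' x x', `|t - t'| <= d -> `|x - x'| <= d -> `|U (t, x) - U (t', x')| <= k;
  lb_source : 0 < G;
  lb_strip : forall al be d s y a b e K M1 M2, `|e| = 1 ->
    T1 <= a -> a < b -> b <= T2 -> 0 < d -> al + d <= be ->
    (forall t, t \in `[a, b] ->
      X1 <= y + s * (t - a) + al /\ y + s * (t - a) + be <= X2) ->
    (forall t x, t \in `[a, b] -> x \in `[y + s * (t - a) + al, y + s * (t - a) + al + d] ->
      e * (f (U (t, x)) - s * U (t, x)) <= M1) ->
    (forall t x, t \in `[a, b] -> x \in `[y + s * (t - a) + be - d, y + s * (t - a) + be] ->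
      M2 <= e * (f (U (t, x)) - s * U (t, x))) ->
    0 <= K -> M1 - M2 + G * plateau_mass al be d <= K ->
    e * (strip_mean X1 X2 U al be d b (y + s * (b - a)) - strip_mean X1 X2 U al be d a y) <=
      K * (b - a)
}.

Lemma local_speed_ge0 (R : realType) (f F : R -> R) (U : R * R -> R)
    (G T1 T2 X1 X2 S vl vh : R) : local_balance f F U G T1 T2 X1 X2 S vl vh -> 0 <= S.
Proof.
by move=> lb; exact: le_trans (normr_ge0 _) (lb_speed lb (lb_range lb (0, 0))).
Qed.

(* The strip lies on one side of the line of slope [s = F (U (t, y))] through
   [(t, y)].  Where [F] is monotone, the relative flux [f - s id] is extremal at
   [U (t, y)], hence the flux through the outer edge has the favourable sign; on
   the inner edge it differs from its extremal value by [k'] only, since [U] is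
   close to [U (t, y)] there.  For [sg = 1], the mean over the right strip
   thus increases at rate at most [2 * G], and the mean over the left strip
   decreases at rate at most [2 * G]. *)
Lemma strip_step (R : realType) (f F : R -> R) (U : R * R -> R)
    (G T1 T2 X1 X2 S vl vh : R)
    (sg ep d h0 k k' r t y zl zh a b : R) (s := F (U (t, y))) :
  local_balance f F U G T1 T2 X1 X2 S vl vh ->
  `|sg| = 1 -> 0 < d -> d <= ep / 4 -> ep <= r -> k' <= G * (ep / 2) ->
  (forall t' x, `|t' - t| <= h0 -> `|x - y| <= ep + h0 * S -> `|U (t', x) - U (t, y)| <= k) ->
  (forall t' x, `|t' - t| <= h0 -> `|x - y| <= d + h0 * S ->
    2 * S * `|U (t', x) - U (t, y)| <= k') ->
  (forall x x', zl <= x -> x <= x' -> x' <= zh -> 0 <= sg * (F x' - F x)) ->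
  zl + k <= U (t, y) <= zh - k -> a < b -> b - a <= h0 -> a <= t <= b ->
  T1 <= a -> b <= T2 ->
  X1 + r <= y + s * (a - t) <= X2 - r -> X1 + r <= y + s * (b - t) <= X2 - r ->
  sg * (strip_mean X1 X2 U 0 ep d b (y + s * (b - t)) -
        strip_mean X1 X2 U 0 ep d a (y + s * (a - t))) <=
    2 * G * plateau_mass 0 ep d * (b - a) /\
  - sg * (strip_mean X1 X2 U (- ep) 0 d b (y + s * (b - t)) -
          strip_mean X1 X2 U (- ep) 0 d a (y + s * (a - t))) <=
    2 * G * plateau_mass (- ep) 0 d * (b - a).
Proof.
move=> [_ hf bF rangeU _ G_gt0 strip] sgn d0 dep epr k'G near near' mF Uz ab bah atb T1a bT2 ya yb.
have sgn' : `|- sg| = 1 by rewrite normrN.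
have sS : `|s| <= S by apply: bF.
have d_le_ep : d <= ep by move: d0 dep; clear; lra.
have ep0 : 0 < ep by move: d0 dep; clear; lra.
have line t' : y + s * (a - t) + s * (t' - a) = y + s * (t' - t) by clear; ring.
have inr t' : t' \in `[a, b] -> X1 + r <= y + s * (t' - t) <= X2 - r.
  rewrite in_itv /= => tt'.
  have [s0|s0] := leP 0 s.
    have h1 : s * (a - t) <= s * (t' - t).
      by apply: ler_wpM2l => //; move: tt'; clear; lra.
    have h2 : s * (t' - t) <= s * (b - t).
      by apply: ler_wpM2l => //; move: tt'; clear; lra.
    by move: ya yb h1 h2; clear; lra.
  have h1 : s * (b - t) <= s * (t' - t).
    by apply: ler_wnM2l; [exact: ltW|move: tt'; clear; lra].
  have h2 : s * (t' - t) <= s * (a - t).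
    by apply: ler_wnM2l; [exact: ltW|move: tt'; clear; lra].
  by move: ya yb h1 h2; clear; lra.
have near_line t' : t' \in `[a, b] -> `|t' - t| <= h0 /\ `|s * (t' - t)| <= h0 * S.
  rewrite in_itv /= => tt'.
  have h1 : `|t' - t| <= h0 by rewrite ler_norml; move: tt' atb bah; clear; lra.
  by split => //; rewrite normrM mulrC; apply: ler_pM.
have dist t' x c : t' \in `[a, b] -> `|x - (y + s * (t' - t))| <= c ->
    `|t' - t| <= h0 /\ `|x - y| <= c + h0 * S.
  move=> tt' xx; have [n1 n2] := near_line _ tt'; split => //.
  have -> : x - y = (x - (y + s * (t' - t))) + s * (t' - t) by clear; ring.
  by rewrite (le_trans (ler_normD _ _)) // lerD.
pose q (v : R) := f v - s * v.
have q_ge t' x : t' \in `[a, b] -> `|x - (y + s * (t' - t))| <= ep ->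
    sg * q (U (t, y)) <= sg * q (U (t', x)).
  move=> tt' xx; have [n1 n2] := dist _ _ _ tt' xx.
  have := near _ _ n1 n2; rewrite ler_norml => Ukk.
  have zU : zl <= U (t, y) <= zh.
    by have k0 := le_trans (normr_ge0 _) (near _ _ n1 n2); move: k0 Uz; clear; lra.
  have zU' : zl <= U (t', x) <= zh by move: Uz Ukk; clear; lra.
  rewrite -subr_ge0 /q; have := tangent_ge0 hf mF zU zU'; rewrite -/s.
  have -> // : sg * (f (U (t', x)) - f (U (t, y)) - s * (U (t', x) - U (t, y))) =
    sg * (f (U (t', x)) - s * U (t', x)) - sg * (f (U (t, y)) - s * U (t, y)) by clear; ring.
have q_le t' x : t' \in `[a, b] -> `|x - (y + s * (t' - t))| <= d ->
    sg * q (U (t', x)) <= sg * q (U (t, y)) + k'.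
  move=> tt' xx; have [n1 n2] := dist _ _ _ tt' xx.
  have := tangent_lipschitz hf bF (rangeU (t, y)) (rangeU (t', x)); rewrite -/s => tl.
  have h2 : sg * (f (U (t', x)) - f (U (t, y)) - s * (U (t', x) - U (t, y))) <= k'.
    rewrite (le_trans (ler_norm _)) // normrM sgn mul1r.
    exact: le_trans tl (near' _ _ n1 n2).
  rewrite -lerBlDl /q.
  have -> // : sg * (f (U (t', x)) - s * U (t', x)) - sg * (f (U (t, y)) - s * U (t, y)) =
    sg * (f (U (t', x)) - f (U (t, y)) - s * (U (t', x) - U (t, y))) by clear; ring.
have G0 := ltW G_gt0.
have albeR : 0 + d <= ep by rewrite add0r.
have albeL : - ep + d <= 0 by move: d_le_ep; clear; lra.
(* The mass is at least ep - 2d >= ep/2, so the inner-edge error [k'] is at most G times the mass.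
   This is the second G in the rate 2G. *)
have k'm al be : be - al = ep -> al + d <= be -> k' <= G * plateau_mass al be d.
  move=> E /(plateau_mass_bounds d0)/andP[m1 _]; rewrite (le_trans k'G) // ler_wpM2l //.
  by move: m1 dep; rewrite E; clear; lra.
have m_ge0 al be : be - al = ep -> al + d <= be -> 0 <= 2 * G * plateau_mass al be d.
  move=> E /(plateau_mass_bounds d0)/andP[m1 _]; rewrite mulr_ge0 ?mulr_ge0 //.
  by move: m1 dep d0; rewrite E; clear; lra.
rewrite -[y + s * (b - t)]line; split.
- apply: (strip
      0 ep d s (y + s * (a - t)) a b sg (2 * G * plateau_mass 0 ep d)
      (sg * q (U (t, y)) + k') (sg * q (U (t, y)))) => //.
  + by move=> t' tt'; rewrite line; have := inr _ tt'; move: ep0 epr; clear; lra.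
  + move=> t' x tt'; rewrite line in_itv /= => xx; apply: q_le => //.
    by rewrite ler_norml; move: xx d0; clear; lra.
  + move=> t' x tt'; rewrite line in_itv /= => xx; apply: q_ge => //.
    by rewrite ler_norml; move: xx d_le_ep ep0; clear; lra.
  + by apply: m_ge0 => //; rewrite subr0.
  + have := k'm 0 ep (subr0 _) albeR; clear; lra.
(* For the left strip the inner edge is the right one, and the sign [- sg] turns extremality at the
   outer edge into the required upper bound. *)
- apply: (strip
      (- ep) 0 d s (y + s * (a - t)) a b (- sg) (2 * G * plateau_mass (- ep) 0 d)
      (- (sg * q (U (t, y)))) (- (sg * q (U (t, y)) + k'))) => //.
  + by move=> t' tt'; rewrite line; have := inr _ tt'; move: ep0 epr; clear; lra.
  + move=> t' x tt'; rewrite line in_itv /= => xx; rewrite mulNr lerN2; apply: q_ge => //.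
    by rewrite ler_norml; move: xx d_le_ep ep0; clear; lra.
  + move=> t' x tt'; rewrite line in_itv /= => xx; rewrite mulNr lerN2; apply: q_le => //.
    by rewrite ler_norml; move: xx d0; clear; lra.
  + by apply: m_ge0 => //; rewrite sub0r opprK.
  + have := k'm (- ep) 0 (_ : 0 - - ep = ep) albeL; rewrite sub0r opprK => /(_ erefl).
    by clear; lra.
Qed.

(** The factor 3 guarantees a mass of at least [d], so that the division is legitimate. *)
Lemma normalized_mean_close (R : realType) (U : R * R -> R) (X1 X2 al be d t y k : R) :
  continuous U -> 0 < d -> al + 3 * d <= be ->
  X1 <= y + al -> y + be <= X2 ->
  (forall x, y + al <= x <= y + be -> `|U (t, x) - U (t, y)| <= k) ->
  `|strip_mean X1 X2 U al be d t y / plateau_mass al be d - U (t, y)| <= k.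
Proof.
move=> cU d0 albe3 yal ybe Uk.
have albe : al + d <= be by move: d0 albe3; clear; lra.
have m0 : 0 < plateau_mass al be d.
  by have /andP[+ _] := plateau_mass_bounds d0 albe; move: d0 albe3; clear; lra.
have -> : strip_mean X1 X2 U al be d t y / plateau_mass al be d - U (t, y) =
    (strip_mean X1 X2 U al be d t y - U (t, y) * plateau_mass al be d) / plateau_mass al be d.
  by rewrite mulrBl mulfK ?gt_eqF.
rewrite normrM normfV [X in _ / X](gtr0_norm m0) ler_pdivrMr //.
by apply: strip_mean_close => // x; rewrite in_itv /=; exact: Uk.
Qed.

(* [Wu] and [Wl] are the means over the two one-sided strips, exchanged if
   [sg] and the direction of time [th] disagree. *)
Lemma zone_step (R : realType) (f F : R -> R) (U : R * R -> R)
    (G T1 T2 X1 X2 S vl vh : R)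
    (sg th r k : R) :
  local_balance f F U G T1 T2 X1 X2 S vl vh -> sg ^+ 2 = 1 -> th ^+ 2 = 1 -> 0 < r -> 0 < k ->
  exists (Wu Wl : R -> R -> R) (h0 : R), [/\ 0 < h0,
    forall t y, X1 + r <= y <= X2 - r ->
      `|Wu t y - U (t, y)| <= k /\ `|Wl t y - U (t, y)| <= k &
    forall t y zl zh h (s := F (U (t, y))),
      (forall x x', zl <= x -> x <= x' -> x' <= zh -> 0 <= sg * (F x' - F x)) ->
      zl + k <= U (t, y) <= zh - k -> 0 < h <= h0 ->
      T1 <= t <= T2 -> T1 <= t + th * h <= T2 ->
      X1 + r <= y <= X2 - r -> X1 + r <= y + s * (th * h) <= X2 - r ->
      Wu (t + th * h) (y + s * (th * h)) <= Wu t y + 2 * G * h /\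
      Wl t y - 2 * G * h <= Wl (t + th * h) (y + s * (th * h))].
Proof.
move=> lb sg2 th2 r0 k0; have S0 := local_speed_ge0 lb.
have cU := lb_continuous lb; have ucU := lb_unif lb; have G0 := lb_source lb.
have [dk dk0 Udk] := ucU _ k0.
have [ep [ep0 epdk epr]] : exists ep, [/\ 0 < ep, ep <= dk / 2 & ep <= r].
  exists (Num.min (dk / 2) r); rewrite lt_min !ge_min !lexx orbT r0 andbT divr_gt0 //.
have [k' [k'0 k'E]] : exists k', 0 < k' /\ k' <= G * (ep / 2).
  by exists (G * (ep / 2)); rewrite mulr_gt0 ?divr_gt0.
(* Dividing by 2 * S + 1 instead of 2 * S covers the case S = 0. *)
have S1 : 0 < 2 * S + 1 by move: S0; clear; lra.
have [d' d'0 Ud'] := @ucU (k' / (2 * S + 1)) (divr_gt0 k'0 S1).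
have [d [d0 dep dd']] : exists d, [/\ 0 < d, d <= ep / 4 & d <= d' / 2].
  by exists (Num.min (ep / 4) (d' / 2)); rewrite lt_min !ge_min !lexx orbT !divr_gt0.
(* Over a time [h0] a line of slope at most [S] moves by at most half of either modulus. Only
   uniform moduli enter, so one step length serves at every vertex. *)
have [h0 [h00 h0dk h0d' h0dk' h0d'']] : exists h0,
    [/\ 0 < h0, h0 <= dk, h0 <= d', h0 * S <= dk / 2 & h0 * S <= d' / 2].
  have hS : 0 < S + 1 by move: S0; clear; lra.
  have m0 : 0 < Num.min (dk / 2) (d' / 2) by rewrite lt_min !divr_gt0.
  have h00 : 0 < Num.min (dk / 2) (d' / 2) / (S + 1) by rewrite divr_gt0.
  have h0E : Num.min (dk / 2) (d' / 2) / (S + 1) * (S + 1) = Num.min (dk / 2) (d' / 2).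
    by rewrite divfK // gt_eqF.
  exists (Num.min (dk / 2) (d' / 2) / (S + 1)); move: h00 h0E.
  set h0 := _ / (S + 1); set m := Num.min _ _ => h00 h0E.
  have m1 : m <= dk / 2 by rewrite ge_min lexx.
  have m2 : m <= d' / 2 by rewrite ge_min lexx orbT.
  have Sh : 0 <= h0 * S by rewrite mulr_ge0 // ltW.
  have h0E' : h0 * S + h0 = m by rewrite -h0E; clear; ring.
  clearbody h0 m; split => //; move: m1 m2 Sh h0E' h00 dk0 d'0; clear; lra.
have near t y t' x : `|t' - t| <= h0 -> `|x - y| <= ep + h0 * S ->
    `|U (t', x) - U (t, y)| <= k.
  move=> h1 h2; apply: Udk; first exact: le_trans h1 h0dk.
  by apply: le_trans h2 _; move: epdk h0dk'; clear; lra.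
have near' t y t' x : `|t' - t| <= h0 -> `|x - y| <= d + h0 * S ->
    2 * S * `|U (t', x) - U (t, y)| <= k'.
  move=> h1 h2; have Ud : `|U (t', x) - U (t, y)| <= k' / (2 * S + 1).
    apply: Ud'; first exact: le_trans h1 h0d'.
    by apply: le_trans h2 _; move: dd' h0d''; clear; lra.
  apply: (@le_trans _ _ ((2 * S + 1) * (k' / (2 * S + 1)))).
    by apply: ler_pM => //; [rewrite mulr_ge0|rewrite lerDl].
  by rewrite mulrC divfK // gt_eqF.
have albeR : 0 + d <= ep by move: d0 dep; clear; lra.
have albeL : - ep + d <= 0 by move: d0 dep; clear; lra.
have /andP[mR1 _] := plateau_mass_bounds d0 albeR.
have /andP[mL1 _] := plateau_mass_bounds d0 albeL.
have mR0 : 0 < plateau_mass 0 ep d by move: mR1 dep d0; clear; lra.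
have mL0 : 0 < plateau_mass (- ep) 0 d by move: mL1 dep d0; clear; lra.
pose WR t y := strip_mean X1 X2 U 0 ep d t y / plateau_mass 0 ep d.
pose WL t y := strip_mean X1 X2 U (- ep) 0 d t y / plateau_mass (- ep) 0 d.
have close t y x : `|x - y| <= ep -> `|U (t, x) - U (t, y)| <= k.
  move=> xy; apply: near; first by rewrite subrr normr0 ltW.
  by rewrite (le_trans xy) // lerDl mulr_ge0 // ltW.
have closeR t y : X1 + r <= y <= X2 - r -> `|WR t y - U (t, y)| <= k.
  move=> yr; apply: normalized_mean_close => //;
    [by move: dep d0; clear; lra|by move: yr r0; clear; lra|by move: yr epr; clear; lra|].
  by move=> x xx; apply: close; rewrite ler_norml; move: xx ep0; clear; lra.
have closeL t y : X1 + r <= y <= X2 - r -> `|WL t y - U (t, y)| <= k.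
  move=> yr; apply: normalized_mean_close => //;
    [by move: dep d0; clear; lra|by move: yr epr; clear; lra|by move: yr r0; clear; lra|].
  by move=> x xx; apply: close; rewrite ler_norml; move: xx ep0; clear; lra.
have sgE := sqr1_cases sg2; have thE := sqr1_cases th2.
have sgn : `|sg| = 1 by case: sgE => ->; rewrite ?normrN normr1.
have step t y zl zh a b (s := F (U (t, y))) :
    (forall x x', zl <= x -> x <= x' -> x' <= zh -> 0 <= sg * (F x' - F x)) ->
    zl + k <= U (t, y) <= zh - k -> a < b -> b - a <= h0 -> a <= t <= b ->
    T1 <= a -> b <= T2 ->
    X1 + r <= y + s * (a - t) <= X2 - r -> X1 + r <= y + s * (b - t) <= X2 - r ->
    sg * (WR b (y + s * (b - t)) - WR a (y + s * (a - t))) <= 2 * G * (b - a) /\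
    - sg * (WL b (y + s * (b - t)) - WL a (y + s * (a - t))) <= 2 * G * (b - a).
  move=> mF Uz ab bah atb T1a bT2 ya yb.
  have [] := strip_step lb sgn d0 dep epr k'E (near t y) (near' t y) mF Uz ab bah atb T1a bT2 ya yb.
  rewrite -/s /WR /WL -!mulrBl !mulrA => hR hL.
  by split; rewrite ler_pdivrMr // mulrAC.
exists (if sg == th then WR else WL), (if sg == th then WL else WR), h0; split => //.
  by move=> t y yr; case: ifP => _; split; [exact: closeR|exact: closeL|exact: closeL|exact: closeR].
have n11 : (1 == - 1 :> R) = false by apply/eqP; clear; lra.
have n11' : (- 1 == 1 :> R) = false by rewrite eq_sym.
move=> t y zl zh h s mF Uz /andP[hp hh0] tT tT' yr yr'.
have [thp|thn] := thE.
  rewrite thp !mul1r in tT' yr' *.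
  have := step t y zl zh t (t + h) mF Uz.
  rewrite -/s !subrr mulr0 addr0 [t + h - t](_ : _ = h); last by clear; ring.
  have tt : t < t + h by rewrite ltrDl.
  have tth : t <= t <= t + h by rewrite lexx ltW.
  have [tT1 _] := andP tT; have [_ tT2] := andP tT'.
  move=> /(_ tt hh0 tth tT1 tT2 yr yr') [].
  by case: sgE => ->; rewrite ?eqxx ?n11 ?n11'; clear; lra.
rewrite thn !mulN1r in tT' yr' *.
have := step t y zl zh (t - h) t mF Uz.
rewrite -/s !subrr mulr0 addr0 [t - h - t](_ : _ = - h); last by clear; ring.
have -> : t - (t - h) = h by clear; ring.
have tt : t - h < t by rewrite ltrBlDr ltrDl.
have tth : t - h <= t <= t by rewrite lexx andbT ltW.
have [_ tT1] := andP tT; have [tT2 _] := andP tT'.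
move=> /(_ tt hh0 tth tT2 tT1 yr' yr) [].
by case: sgE => ->; rewrite ?eqxx ?n11 ?n11'; clear; lra.
Qed.

(** The step is signed: it is later taken to be [th * h], so that the polygon runs forward or
    backward in time. *)
Fixpoint euler (R : realType) (V : R * R -> R) (t h y : R) (i : nat) : R :=
  if i is j.+1 then euler V t h y j + V (t + j%:R * h, euler V t h y j) * h else y.

(** Only the means are propagated by the induction, so the increments [2 * G * h] add up without
    further error and [k] appears once in the conclusion, for any number of steps. *)
Lemma euler_trajectory (R : realType) (f F : R -> R) (U : R * R -> R)
    (G T1 T2 X1 X2 S vl vh sg th r k : R) :
  local_balance f F U G T1 T2 X1 X2 S vl vh -> sg ^+ 2 = 1 -> th ^+ 2 = 1 -> 0 < r -> 0 < k ->
  exists2 h0 : R, 0 < h0 & forall t y zl zh om T h (y_ := euler (F \o U) t (th * h) y),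
    (forall x x', zl <= x -> x <= x' -> x' <= zh -> 0 <= sg * (F x' - F x)) ->
    zl + om <= U (t, y) <= zh - om -> k <= om / 4 -> 2 * G * T <= om / 2 ->
    T1 <= t <= T2 -> T1 <= t + th * T <= T2 ->
    X1 + r + S * T <= y <= X2 - r - S * T -> 0 < h <= h0 ->
    forall i, i%:R * h <= T ->
      `|U (t + i%:R * (th * h), y_ i) - U (t, y)| <= 2 * G * (i%:R * h) + k /\
      `|y_ i - y| <= S * (i%:R * h).
Proof.
move=> lb sg2 th2 r0 k0; have S0 := local_speed_ge0 lb; have G0 := lb_source lb.
(* Half of [k] for each comparison of [U] with the means, at the start and at the current vertex. *)
have k20 : 0 < k / 2 by rewrite divr_gt0.
have [Wu [Wl [h0 [h00 close step]]]] := zone_step lb sg2 th2 r0 k20.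
exists h0 => // t y zl zh om T h y_ mF Uz kom GT tT tT' yX /andP[hp hh0].
have inT a : 0 <= a -> a <= T -> T1 <= t + th * a <= T2.
  move: tT tT'; case: (sqr1_cases th2) => ->; clear; lra.
have tE i : t + i%:R * (th * h) = t + th * (i%:R * h) by clear; ring.
have inX i : i%:R * h <= T -> `|y_ i - y| <= S * (i%:R * h) -> X1 + r <= y_ i <= X2 - r.
  move=> iT; rewrite ler_norml => yi.
  have : S * (i%:R * h) <= S * T by apply: ler_wpM2l.
  by move: yX yi; clear; lra.
have ih_ge0 i : 0 <= i%:R * h by rewrite mulr_ge0 // ltW.
have Ubound i : i%:R * h <= T -> `|y_ i - y| <= S * (i%:R * h) ->
    Wu (t + i%:R * (th * h)) (y_ i) <= Wu t y + 2 * G * (i%:R * h) ->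
    Wl t y - 2 * G * (i%:R * h) <= Wl (t + i%:R * (th * h)) (y_ i) ->
    `|U (t + i%:R * (th * h), y_ i) - U (t, y)| <= 2 * G * (i%:R * h) + k.
  move=> iT yi; have := inX i iT yi => yXi.
  have ST : 0 <= S * T.
    by apply: mulr_ge0 => //; apply: le_trans (ih_ge0 i) iT.
  have yX' : X1 + r <= y <= X2 - r by move: yX ST; clear; lra.
  have [] := close (t + i%:R * (th * h)) (y_ i) yXi; have [] := close t y yX'.
  move: (Wu _ _) (Wl _ _) (Wu _ _) (Wl _ _) (U _) (U _) => a b c d u1 u2.
  by rewrite !ler_norml; clear; lra.
suff inv i : i%:R * h <= T -> [/\ `|y_ i - y| <= S * (i%:R * h),
    Wu (t + i%:R * (th * h)) (y_ i) <= Wu t y + 2 * G * (i%:R * h) &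
    Wl t y - 2 * G * (i%:R * h) <= Wl (t + i%:R * (th * h)) (y_ i)].
  by move=> i iT; have [h1 h2 h3] := inv i iT; split => //; exact: Ubound.
elim: i => [|i IH].
  by rewrite !mul0r !mulr0 !addr0 subr0 /y_ /= subrr normr0.
move=> iT; have iE : i.+1%:R * h = i%:R * h + h by rewrite -natr1 mulrDl mul1r.
have iT' : i%:R * h <= T by move: iT hp; rewrite iE; clear; lra.
have [h1 h2 h3] := IH iT'.
have Ui := Ubound i iT' h1 h2 h3.
have yXi := inX i iT' h1.
set ti := t + i%:R * (th * h) in h2 h3 Ui.
have tiE : t + i.+1%:R * (th * h) = ti + th * h.
  by rewrite /ti -natr1; clear; ring.
have yE : y_ i.+1 = y_ i + F (U (ti, y_ i)) * (th * h) by [].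
have sS : `|F (U (ti, y_ i))| <= S by apply: (lb_speed lb); exact: (lb_range lb).
have yS : `|y_ i.+1 - y| <= S * (i.+1%:R * h).
  rewrite yE iE mulrDr addrAC (le_trans (ler_normD _ _)) // lerD // normrM.
  apply: ler_pM => //; rewrite normrM (gtr0_norm hp).
  by case: (sqr1_cases th2) => ->; rewrite ?normrN normr1 mul1r.
have Gi : 2 * G * (i%:R * h) <= 2 * G * T by apply: ler_wpM2l => //; rewrite mulr_ge0 // ltW.
have := step ti (y_ i) zl zh h mF.
rewrite -tiE -yE; case => //.
(* The drift is at most 2GT + k <= om/2 + om/4, and the margin k/2 <= om/8 demanded by [zone_step]
   still fits into [om]. *)
- by move: Ui Uz kom k0 Gi GT; rewrite ler_norml; move: (U _) (U _) => a b; clear; lra.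
- by rewrite hp hh0.
- by rewrite /ti tE; exact: inT.
- by rewrite tE; exact: inT.
- exact: inX.
have GE : 2 * G * (i.+1%:R * h) = 2 * G * (i%:R * h) + 2 * G * h by rewrite iE mulrDr.
rewrite GE => h4 h5; split; first exact: yS.
  by apply: le_trans h4 _; rewrite addrA lerD2r.
by apply: le_trans _ h5; rewrite opprD addrA lerD2r.
Qed.

(** A polygon has to stop exactly at a prescribed time, so the step must divide [T]. *)
Lemma small_step (R : realType) (T h1 : R) : 0 < T -> 0 < h1 ->
  exists N h, [/\ 0 < h, h <= h1 & N%:R * h = T].
Proof.
move=> T0 h10; have q0 : 0 <= T / h1 by rewrite divr_ge0 ?ltW.
have := archi_boundP q0; set N := Num.bound _ => hN.
have N0 : 0 < N%:R :> R by exact: le_lt_trans hN.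
exists N, (T / N%:R); split; first by rewrite divr_gt0.
  by rewrite ler_pdivrMr // mulrC -ler_pdivrMr // ltW.
by rewrite mulrC divfK // gt_eqF.
Qed.

(* In the direction of time in which the speeds of the polygons issued from [x1]
   and [x2] make them approach each other, the distance decreases at least at
   rate [c * (w / 2) ^+ n].  The polygons cannot meet, because the values
   they carry stay [w / 2] apart. *)
Lemma crossing_bound (R : realType) (f F : R -> R) (U : R * R -> R)
    (G T1 T2 X1 X2 S vl vh sg r zl zh c t x1 x2 : R) (n : nat)
    (w := `|U (t, x2) - U (t, x1)|) (T := w / (16 * G)) :
  local_balance f F U G T1 T2 X1 X2 S vl vh -> sg ^+ 2 = 1 -> 0 < r -> 0 <= c ->
  (forall x x', zl <= x -> x <= x' -> x' <= zh -> c * (x' - x) ^+ n <= sg * (F x' - F x)) ->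
  x1 < x2 -> 0 < w ->
  zl + w / 4 <= U (t, x1) <= zh - w / 4 -> zl + w / 4 <= U (t, x2) <= zh - w / 4 ->
  T1 <= t - T -> t + T <= T2 ->
  X1 + r + S * T <= x1 -> x2 <= X2 - r - S * T ->
  T * (c * (w / 2) ^+ n) <= x2 - x1.
Proof.
move=> lb sg2 r0 c0 sF x12 w0 z1 z2 tT1 tT2 xX1 xX2.
have S0 := local_speed_ge0 lb; have G0 := lb_source lb.
have T0 : 0 < T by rewrite divr_gt0 ?mulr_gt0.
have GT : 2 * G * T = w / 8 by rewrite /T; field; rewrite gt_eqF.
have mF x x' : zl <= x -> x <= x' -> x' <= zh -> 0 <= sg * (F x' - F x).
  move=> h1 h2 h3; apply: le_trans (sF _ _ h1 h2 h3).
  by rewrite mulr_ge0 // exprn_ge0 // subr_ge0.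
have [et [et2 wE]] : exists et : R, et ^+ 2 = 1 /\ U (t, x2) - U (t, x1) = et * w.
  rewrite /w; have [h|h] := leP 0 (U (t, x2) - U (t, x1)).
    by exists 1; rewrite expr1n mul1r ger0_norm.
  by exists (- 1); rewrite sqrrN expr1n mulN1r ltr0_norm // opprK.
(* [et] is the sign of the difference of the values and [sg] the direction of monotonicity of [F],
   so their product is the sign of the difference of speeds. Time runs against it, which makes the
   gap shrink. *)
pose th := - (sg * et).
have th2 : th ^+ 2 = 1 by rewrite sqrrN exprMn sg2 et2 mulr1.
have k0 : 0 < w / 16 by rewrite divr_gt0.
have [h0 h00 traj] := euler_trajectory lb sg2 th2 r0 k0.
have w40 : 0 < w / 4 by rewrite divr_gt0.
have [d d0 Ud] := lb_unif lb w40.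
have S1 : 0 < 2 * S + 1 by move: S0; clear; lra.
(* In one step the gap shrinks by at most 2Sh <= d. Polygons that cross during a step were thus
   within [d] of each other before it and carried values at most w/4 apart, which contradicts their
   separation by w/2. *)
have h10 : 0 < Num.min h0 (d / (2 * S + 1)) by rewrite lt_min h00 divr_gt0.
have [N [h [hp hh NT]]] := small_step T0 h10.
have hh0 : 0 < h <= h0 by rewrite hp (le_trans hh) // ge_min lexx.
have hd : 2 * S * h <= d.
  apply: (@le_trans _ _ ((2 * S + 1) * (d / (2 * S + 1)))).
    apply: ler_pM; [by rewrite mulr_ge0|exact: ltW|by rewrite lerDl|].
    by rewrite (le_trans hh) // ge_min lexx orbT.
  by rewrite mulrC divfK // gt_eqF.
have tT : T1 <= t <= T2 by move: tT1 tT2 T0; clear; lra.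
have tT' : T1 <= t + th * T <= T2.
  by move: tT1 tT2 T0; case: (sqr1_cases th2) => ->; clear; lra.
have ST : 0 <= S * T by rewrite mulr_ge0 // ltW.
have yX1 : X1 + r + S * T <= x1 <= X2 - r - S * T by move: xX1 xX2 x12; clear; lra.
have yX2 : X1 + r + S * T <= x2 <= X2 - r - S * T by move: xX1 xX2 x12; clear; lra.
have kom : w / 16 <= w / 4 / 4 by clear; lra.
have GT' : 2 * G * T <= w / 4 / 2 by rewrite GT; clear; lra.
have tr1 := traj t x1 zl zh (w / 4) T h mF z1 kom GT' tT tT' yX1 hh0.
have tr2 := traj t x2 zl zh (w / 4) T h mF z2 kom GT' tT tT' yX2 hh0.
set y1 := euler _ _ _ _ in tr1; set y2 := euler _ _ _ _ in tr2.
(* Each value drifts by at most 2GT + w/16 = 3w/16, so the difference keeps its sign and at least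
   5/8 of its size. *)
have gap i : i%:R * h <= T ->
    let a := U (t + i%:R * (th * h), y1 i) in let b := U (t + i%:R * (th * h), y2 i) in
    [/\ w / 2 <= et * (b - a), c * (w / 2) ^+ n <= sg * et * (F b - F a) &
       sg * et * (F b - F a) <= 2 * S].
  move=> iT; have [u1 _] := tr1 i iT; have [u2 _] := tr2 i iT.
  have Gi : 2 * G * (i%:R * h) <= w / 8.
    by rewrite -GT; apply: ler_wpM2l => //; rewrite mulr_ge0 // ltW.
  have sa := lb_speed lb (lb_range lb (t + i%:R * (th * h), y1 i)).
  have sb := lb_speed lb (lb_range lb (t + i%:R * (th * h), y2 i)).
  cbv zeta; move: u1 u2 sa sb; move: (U (t + _, y1 i)) (U (t + _, y2 i)) => a b.
  move=> u1 u2 sa sb.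
  have a1 : `|a - U (t, x1)| <= 3 / 16 * w by move: u1 Gi; clear; lra.
  have b1 : `|b - U (t, x2)| <= 3 / 16 * w by move: u2 Gi; clear; lra.
  have sgS : sg * et * (F b - F a) <= 2 * S.
    move: sa sb; rewrite !ler_norml.
    by case: (sqr1_cases sg2) => ->; case: (sqr1_cases et2) => ->; clear; lra.
  move: a1 b1; rewrite !ler_norml => a1 b1.
  have za : zl <= a <= zh by move: a1 z1 w0; clear; lra.
  have zb : zl <= b <= zh by move: b1 z2 w0; clear; lra.
  have w2 : w / 2 <= et * (b - a).
    by move: a1 b1 wE w0; case: (sqr1_cases et2) => ->; clear; lra.
  split => //.
  have w20 : 0 <= w / 2 by rewrite divr_ge0 // ltW.
  have pw (q : R) : w / 2 <= q -> c * (w / 2) ^+ n <= c * q ^+ n.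
    by move=> wq; apply: ler_wpM2l => //; apply: lerXn2r; rewrite ?nnegrE // (le_trans w20).
  move: w2; case: (sqr1_cases et2) => -> w2.
    rewrite mulr1; apply: le_trans (pw _ _) (sF a b _ _ _); move: w2 za zb w0; clear; lra.
  have -> : sg * -1 * (F b - F a) = sg * (F a - F b) by clear; ring.
  apply: le_trans (pw _ _) (sF b a _ _ _); move: w2 za zb w0; clear; lra.
have inv i : i%:R * h <= T -> 0 < y2 i - y1 i <= x2 - x1 - i%:R * h * (c * (w / 2) ^+ n).
  elim: i => [|i IH]; first by rewrite !mul0r subr0 /y1 /y2 /= lexx subr_gt0 x12.
  move=> iT; have iE : i.+1%:R * h = i%:R * h + h by rewrite -natr1 mulrDl mul1r.
  have iT' : i%:R * h <= T by move: iT hp; rewrite iE; clear; lra.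
  have /andP[D0 Di] := IH iT'; have := gap i iT'; cbv zeta.
  set ti := t + i%:R * (th * h).
  have y1E : y1 i.+1 = y1 i + F (U (ti, y1 i)) * (th * h) by [].
  have y2E : y2 i.+1 = y2 i + F (U (ti, y2 i)) * (th * h) by [].
  have DE : y2 i.+1 - y1 i.+1 =
      y2 i - y1 i - h * (sg * et * (F (U (ti, y2 i)) - F (U (ti, y1 i)))).
    by rewrite y1E y2E /th; clear; ring.
  rewrite DE => -[g1 g2 g3].
  have hg2 := ler_wpM2l (ltW hp) g2; have hg3 := ler_wpM2l (ltW hp) g3.
  apply/andP; split; last first.
    by move: Di hg2; rewrite iE mulrDl; clear; lra.
  rewrite ltNge; apply/negP => Dn.
  have yd : `|y2 i - y1 i| <= d.
    by rewrite gtr0_norm //; move: Dn hg3 hd; clear; lra.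
  have := Ud ti ti (y2 i) (y1 i); rewrite subrr normr0 => /(_ (ltW d0) yd).
  rewrite ler_norml; move: g1 w0; case: (sqr1_cases et2) => ->; clear; lra.
have /inv/andP[] : N%:R * h <= T by rewrite NT.
by rewrite NT; move: (y2 N - y1 N) => D; clear; lra.
Qed.

(** * Zones of strict monotonicity of the derivative *)

Lemma nondecreasing_segment (R : realType) (h dh : R -> R) (p q : R) :
  (forall x, is_derive x (1 : R) h (dh x)) ->
  (forall x, p <= x <= q -> 0 <= dh x) -> p <= q -> h p <= h q.
Proof.
move=> hh dh0 pq; have ch : {within `[p, q], continuous h}.
  apply: continuous_subspaceT => z; apply: differentiable_continuous.
  by apply/derivable1_diffP; case: (hh z).
have [x] := MVT_segment pq (fun x _ => hh x) ch.
rewrite in_itv /= => xpq E; rewrite -subr_ge0 E mulr_ge0 ?subr_ge0 //; exact: dh0.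
Qed.

(** Gives (x' - x)^k <= (x' - v)^k - (x - v)^k for v <= x <= x', which turns growth measured from
    [v] into growth on every subinterval. *)
Lemma exprn_superadditive (R : realDomainType) (a b : R) n :
  0 <= a -> 0 <= b -> a ^+ n.+1 + b ^+ n.+1 <= (a + b) ^+ n.+1.
Proof.
move=> a0 b0; elim: n => [|n IH]; first by rewrite !expr1.
have h := ler_wpM2l (addr_ge0 a0 b0) IH.
rewrite [leRHS]exprS; apply: le_trans h.
rewrite ![_ ^+ n.+2]exprS mulrDr !mulrDl.
have h1 : 0 <= b * a ^+ n.+1 by rewrite mulr_ge0 ?exprn_ge0.
have h2 : 0 <= a * b ^+ n.+1 by rewrite mulr_ge0 ?exprn_ge0.
by move: h1 h2; clear; lra.
Qed.

Lemma is_derive_expr_shift (R : realType) (a v x : R) n :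
  is_derive x (1 : R) (fun x => a / n.+1%:R * (x - v) ^+ n.+1) (a * (x - v) ^+ n).
Proof.
have h0 : is_derive x (1 : R) (fun x : R => x - v) 1.
  by apply: is_derive_eq; rewrite subr0.
have h1 : is_derive x (1 : R) (fun x : R => (x - v) ^+ n.+1) (n.+1%:R * (x - v) ^+ n).
  have -> : (fun x : R => (x - v) ^+ n.+1) = (fun x : R => x - v) ^+ n.+1.
    by rewrite exprfctE.
  apply: (is_derive_eq (@is_deriveX R R (fun x : R => x - v) n.+1 x 1 _ h0)).
  by rewrite -[LHS]/(_ * 1) mulr1.
apply: (is_derive_eq (@is_deriveZ _ _ _ _ (a / n.+1%:R) x 1 _ h1)).
by rewrite -[LHS]/(_ * _) mulrA divfK // pnatr_eq0.
Qed.

(** The mean value theorem is applied from order [l] down to 0, each time gaining a factor x - v.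
    The factorial of Taylor's formula is given up. *)
Lemma taylor_zero_le (R : realType) (E : nat -> R -> R) (l : nat) (v r eta : R) :
  (forall j, (j < l)%N -> forall x, is_derive x (1 : R) (E j) (E j.+1 x)) ->
  (forall j, (j < l)%N -> E j v = 0) ->
  (forall x, v <= x <= v + r -> `|E l x| <= eta) ->
  forall x, v <= x <= v + r -> `|E 0%N x| <= eta * (x - v) ^+ l.
Proof.
move=> hE E0 El; suff H m : (m <= l)%N -> forall x, v <= x <= v + r ->
    `|E (l - m)%N x| <= eta * (x - v) ^+ m.
  by move=> x xv; rewrite -(subnn l); exact: H.
elim: m => [|m IH] ml x xv; first by rewrite subn0 expr0 mulr1; exact: El.
have lt_l : (l - m.+1 < l)%N by rewrite ltn_subrL /=; case: (l) ml.
have eqS : (l - m.+1).+1 = (l - m)%N by rewrite subnSK.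
have vx : v <= x by case/andP: xv.
have cE : {within `[v, x], continuous (E (l - m.+1)%N)}.
  apply: continuous_subspaceT => z; apply: differentiable_continuous.
  by apply/derivable1_diffP; case: (hE _ lt_l z).
have [z] := MVT_segment vx (fun x _ => hE _ lt_l x) cE.
rewrite in_itv /= E0 // subr0 eqS => /andP[vz zx] ->.
have xv0 : 0 <= x - v by rewrite subr_ge0.
have zv : v <= z <= v + r by rewrite vz (le_trans zx) //; case/andP: xv.
rewrite normrM (ger0_norm xv0) exprSr mulrA; apply: ler_wpM2r => //.
apply: le_trans (IH (ltnW ml) _ zv) _.
have eta0 : 0 <= eta by apply: le_trans (normr_ge0 _) (El _ zv).
by apply: ler_wpM2l => //; apply: lerXn2r; rewrite ?nnegrE ?subr_ge0 // lerD2r.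
Qed.

(* Near [v] the first nonvanishing derivative keeps its sign; integrating back to
   order 2 bounds [sg * D 2] below by a multiple of [(x - v) ^+ (j - 2)]. *)
Lemma right_zone (R : realType) (D : nat -> R -> R) (l j : nat) (v : R) :
  (1 < j <= l)%N ->
  (forall i, (i < l)%N -> forall x, is_derive x (1 : R) (D i) (D i.+1 x)) ->
  (forall i, (1 < i < j)%N -> D i v = 0) -> {for v, continuous (D j)} -> D j v != 0 ->
  exists r c sg : R, [/\ 0 < r <= 1, 0 < c, sg ^+ 2 = 1 &
    forall x x', v <= x -> x <= x' -> x' <= v + r ->
      c * (x' - x) ^+ l.-1 <= sg * (D 1%N x' - D 1%N x)].
Proof.
move=> /andP[j1 jl] hD D0 cD Dn0.
have [sg [sg2 sgD]] : exists sg : R, sg ^+ 2 = 1 /\ 0 < sg * D j v.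
  have [h|h|h] := ltgtP (D j v) 0.
  - by exists (- 1); rewrite sqrrN expr1n mulN1r oppr_gt0.
  - by exists 1; rewrite expr1n mul1r.
  - by rewrite h eqxx in Dn0.
have [r [r0 r1 Dr]] : exists r, [/\ 0 < r, r <= 1 &
    forall x, v <= x <= v + r -> sg * D j v / 2 <= sg * D j x].
  have csD : {for v, continuous (fun x => sg * D j x)} by apply: cvgMr; exact: cD.
  have e0 : 0 < sg * D j v / 2 by rewrite divr_gt0.
  move/cvgrPdist_lt : csD => /(_ _ e0) /nbhs_ballP[e /= ep He].
  exists (Num.min (e / 2) 1); split; first by rewrite lt_min divr_gt0 ?ltr01.
    by rewrite ge_min lexx orbT.
  move=> x xv; have : ball v e x.
    rewrite /ball /= ltr_norml.
    have : Num.min (e / 2) 1 <= e / 2 by rewrite ge_min lexx.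
    by move: xv ep; move: (Num.min _ _) => m; clear; lra.
  move=> /He /=; rewrite ltr_norml; move: (sg * D j v) (sg * D j x) => a b; clear; lra.
have low m : (m <= j - 2)%N -> exists2 a, 0 < a &
    forall x, v <= x <= v + r -> a * (x - v) ^+ m <= sg * D (j - m)%N x.
  elim: m => [|m IH] mj.
    by exists (sg * D j v / 2); [rewrite divr_gt0|move=> x /Dr; rewrite expr0 mulr1 subn0].
  have [a a0 Ha] := IH (ltnW mj).
  exists (a / m.+1%:R); first by rewrite divr_gt0.
  move=> x /andP[vx xr].
  have mj1 : (1 < j - m.+1)%N by move: mj j1; clear; lia.
  have eqS : (j - m.+1).+1 = (j - m)%N by move: mj j1; clear; lia.
  have ltl : (j - m.+1 < l)%N by move: mj j1 jl; clear; lia.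
  have mj2 : (1 < j - m.+1 < j)%N by move: mj j1; clear; lia.
  have hd y : is_derive y (1 : R) (fun y => sg * D (j - m.+1)%N y - a / m.+1%:R * (y - v) ^+ m.+1)
      (sg * D (j - m)%N y - a * (y - v) ^+ m).
    apply: is_deriveB; last exact: is_derive_expr_shift.
    by rewrite -eqS; exact: (@is_deriveZ _ _ _ _ sg y 1 _ (hD _ ltl y)).
  have := nondecreasing_segment hd (_ : forall y, v <= y <= x -> _) vx.
  rewrite /= D0 // mulr0 subrr expr0n /= mulr0 subr0 subr_ge0; apply.
  move=> y /andP[vy yx]; rewrite subr_ge0; apply: Ha.
  by rewrite vy (le_trans yx).
have [a a0 Ha] := low (j - 2)%N (leqnn _).
have j2E : (j - (j - 2))%N = 2%N by move: j1; clear; lia.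
have jE : j.-1 = (j - 2).+1 by move: j1; clear; lia.
rewrite j2E in Ha.
exists r, (a / (j - 2).+1%:R), sg; split => //; [by rewrite r0|by rewrite divr_gt0|].
move=> x x' vx xx' xr.
have l1 : (1 < l)%N by move: j1 jl; clear; lia.
have hd y : is_derive y (1 : R) (fun y => sg * D 1%N y - a / (j - 2).+1%:R * (y - v) ^+ (j - 2).+1)
    (sg * D 2%N y - a * (y - v) ^+ (j - 2)).
  apply: is_deriveB; last exact: is_derive_expr_shift.
  exact: (@is_deriveZ _ _ _ _ sg y 1 _ (hD 1%N l1 y)).
have := nondecreasing_segment hd (_ : forall y, x <= y <= x' -> _) xx'.
have dge y : x <= y <= x' -> 0 <= sg * D 2%N y - a * (y - v) ^+ (j - 2).
  move=> /andP[xy yx']; rewrite subr_ge0; apply: Ha.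
  by rewrite (le_trans vx) // (le_trans yx').
move=> /(_ dge) /= mono.
have b0 : 0 <= a / (j - 2).+1%:R by rewrite divr_ge0 // ltW.
have x0 : 0 <= x - v by rewrite subr_ge0.
have xx0 : 0 <= x' - x by rewrite subr_ge0.
have sup := exprn_superadditive (j - 2) xx0 x0.
have xxE : x' - x + (x - v) = x' - v by clear; ring.
rewrite xxE in sup.
(* Here [r <= 1] enters: lowering the exponent from l - 1 to j - 1 enlarges a power of a number in
   [0, 1]. *)
have pw : (x' - x) ^+ l.-1 <= (x' - x) ^+ (j - 2).+1.
  apply: ler_wiXn2l => //; last by move: j1 jl; clear; lia.
  by move: xr vx r1; clear; lra.
have h1 := ler_wpM2l b0 pw; have h2 := ler_wpM2l b0 sup.
rewrite mulrDr in h2; rewrite mulrBr.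
move: mono h1 h2; move: (_ * _ ^+ l.-1) (sg * _) (sg * _) => b1 b2 b3.
move: (_ * (x - v) ^+ _) (_ * (x' - v) ^+ _) (_ * (x' - x) ^+ _) => b4 b5 b6.
by clear; lra.
Qed.

Lemma is_Ck_derive (R : realType) (f : R -> R) (l j : nat) :
  is_Ck l f -> (j < l)%N -> forall x, is_derive x (1 : R) f^`(j)%classic (f^`(j.+1)%classic x).
Proof.
move=> [dD _] jl x; rewrite derive1nS derive1E; apply: derivableP; exact: dD.
Qed.

(** If all derivatives of order 2 to [l] vanished at [v], continuity of the last one would make the
    first-order Taylor remainder o(h^l), against the lower bound c |h|^l. *)
Lemma nonlinear_derivative_neq0 (R : realType) (f : R -> R) (l : nat) (v : R) :
  (2 <= l)%N -> is_Ck l f -> nonlinear f l%:R ->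
  exists j, [/\ (1 < j <= l)%N, f^`(j)%classic v != 0 &
    forall i, (1 < i < j)%N -> f^`(i)%classic v = 0].
Proof.
move=> l2 Cf [_ /(_ v)[c c0 [_ [de de0 Hde]]]].
pose P j := (1 < j <= l)%N && (f^`(j)%classic v != 0).
have [exP|noP] := pselect (exists j, P j).
  case: (ex_minnP exP) => m /andP[ml Dm] min; exists m; split => // i /andP[i1 im].
  apply/eqP; apply: contraTT im => Di; rewrite -leqNgt.
  have [il|li] := leqP i l; first by apply: min; rewrite /P i1 il Di.
  by case/andP: ml => _ ml; rewrite (leq_trans ml) // ltnW.
have Dv j : (1 < j <= l)%N -> f^`(j)%classic v = 0.
  by move=> jl; apply/eqP; apply: contrapT => /negP Dn; apply: noP; exists j; rewrite /P jl.
(* The successive derivatives of the first-order Taylor remainder at [v]; from order 2 on they are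
   those of [f]. *)
pose E (j : nat) (x : R) : R := match j with
  | 0%N => f x - f v - f^`()%classic v * (x - v)
  | 1%N => f^`()%classic x - f^`()%classic v
  | _ => f^`(j)%classic x end.
have l1 : (1 < l)%N by [].
have l0 : (0 < l)%N by exact: ltnW.
have hE j : (j < l)%N -> forall x, is_derive x (1 : R) (E j) (E j.+1 x).
  case: j => [|[|j]] jl x.
  - have h0 : is_derive x (1 : R) f (f^`()%classic x) by exact: (is_Ck_derive Cf l0).
    have h1 : is_derive x (1 : R) (fun x => f x - f v) (f^`()%classic x).
      by apply: is_derive_eq; rewrite subr0.
    have h2 : is_derive x (1 : R) (fun x => f^`()%classic v * (x - v)) (f^`()%classic v).
      have h3 : is_derive x (1 : R) (fun x : R => x - v) 1.
        by apply: is_derive_eq; rewrite subr0.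
      apply: (is_derive_eq (@is_deriveZ _ _ _ _ (f^`()%classic v) x 1 _ h3)).
      by rewrite -[LHS]/(_ * _) mulr1.
    exact: (@is_deriveB _ _ _ _ _ _ _ _ _ h1 h2).
  - have h0 : is_derive x (1 : R) f^`()%classic (f^`(2)%classic x) by exact: (is_Ck_derive Cf l1).
    by apply: is_derive_eq; rewrite subr0.
  - exact: (is_Ck_derive Cf jl).
have E0 j : (j < l)%N -> E j v = 0.
  case: j => [|[|j]] jl /=; rewrite ?subrr ?mulr0 ?subr0 //.
  by apply: (Dv j.+2); apply/andP; split => //; exact: ltnW.
have c20 : 0 < c / 2 by rewrite divr_gt0.
have cl : continuous f^`(l)%classic by case: Cf => _; exact.
have lE : E l = f^`(l)%classic by move: l2; rewrite /E; case: (l) => [|[|m]].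
have lv0 : f^`(l)%classic v = 0 by apply: Dv; rewrite l1 leqnn.
have := cl v; rewrite /continuous_at => /cvgrPdist_lt /(_ _ c20) /nbhs_ballP[e /= e0 He].
have [r [r0 re rde]] : exists r, [/\ 0 < r, r < e & r < de].
  exists (Num.min (e / 2) (de / 2)); rewrite lt_min !divr_gt0 //=.
  have : Num.min (e / 2) (de / 2) <= e / 2 by rewrite ge_min lexx.
  have : Num.min (e / 2) (de / 2) <= de / 2 by rewrite ge_min lexx orbT.
  by move: (Num.min _ _) => m h1 h2; split => //; move: h1 h2 e0 de0; clear; lra.
have El x : v <= x <= v + r -> `|E l x| <= c / 2.
  move=> xv; have : ball v e x.
    by rewrite /ball /= ltr_norml; move: xv re r0; clear; lra.
  by move=> /He /=; rewrite lE lv0 sub0r normrN => /ltW.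
have vr : v <= v + r <= v + r by rewrite lexx andbT lerDl ltW.
have := taylor_zero_le hE E0 El vr; rewrite /= [v + r - v]addrC addKr => up.
have rn : `|r| < de by rewrite gtr0_norm.
have := Hde r rn; rewrite powR_mulrn // (gtr0_norm r0) => lo.
have rl : 0 < r ^+ l by rewrite exprn_gt0.
have := le_trans lo up; rewrite ler_pM2r //; move: c0; clear; lra.
Qed.

(** The left zone is the right zone at -v of the reflected function f(-x). The two signs differ when
    the first nonvanishing derivative has odd order. *)
Lemma local_zones (R : realType) (f : R -> R) (l : nat) (v : R) :
  (2 <= l)%N -> is_Ck l f -> nonlinear f l%:R ->
  exists r c sg1 sg2 : R, [/\ 0 < r, 0 < c, sg1 ^+ 2 = 1, sg2 ^+ 2 = 1 &
    (forall x x', v <= x -> x <= x' -> x' <= v + r ->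
      c * (x' - x) ^+ l.-1 <= sg1 * (f^`()%classic x' - f^`()%classic x)) /\
    (forall x x', v - r <= x -> x <= x' -> x' <= v ->
      c * (x' - x) ^+ l.-1 <= sg2 * (f^`()%classic x' - f^`()%classic x))].
Proof.
move=> l2 Cf nf; have [j [jl Dj D0]] := nonlinear_derivative_neq0 v l2 Cf nf.
have hD i : (i < l)%N -> forall x, is_derive x (1 : R) f^`(i)%classic (f^`(i.+1)%classic x).
  exact: is_Ck_derive.
have cD : continuous f^`(j)%classic by case: Cf => _; apply; case/andP: jl.
have [r1 [c1 [sg1 [/andP[r10 _] c10 sg12 H1]]]] := right_zone jl hD D0 (cD v) Dj.
pose D i (x : R) := (-1) ^+ i * f^`(i)%classic (-1 * x + 0).
have hD' i : (i < l)%N -> forall x, is_derive x (1 : R) (D i) (D i.+1 x).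
  move=> il x; have h := @is_derive_affine R _ (-1) 0 x _ (hD i il (-1 * x + 0)).
  apply: (is_derive_eq (@is_deriveZ _ _ _ _ ((-1) ^+ i) x 1 _ h)).
  by rewrite -[LHS]/(_ * _) /D exprS mulrA; congr (_ * _); rewrite mulrC.
have DE i : D i (- v) = (-1) ^+ i * f^`(i)%classic v.
  by rewrite /D mulN1r opprK addr0.
have D0' i : (1 < i < j)%N -> D i (- v) = 0 by move=> ij; rewrite DE D0 // mulr0.
have cDN : continuous (fun x : R => f^`(j)%classic (-1 * x + 0)).
  move=> x; apply: (@continuous_comp R R R (fun x => -1 * x + 0)); last exact: cD.
  by apply: cvgD; [apply: cvgMr; exact: cvg_id|exact: cvg_cst].
have cD' : {for - v, continuous (D j)} by apply: cvgMr; exact: cDN.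
have Dj' : D j (- v) != 0 by rewrite DE mulf_neq0 // expf_neq0 // oppr_eq0 oner_neq0.
have [r2 [c2 [sg2 [/andP[r20 _] c20 sg22 H2]]]] := right_zone jl hD' D0' cD' Dj'.
exists (Num.min r1 r2), (Num.min c1 c2), sg1, sg2; split; rewrite ?lt_min ?r10 ?c10 //.
have rr1 : Num.min r1 r2 <= r1 by rewrite ge_min lexx.
have rr2 : Num.min r1 r2 <= r2 by rewrite ge_min lexx orbT.
have cc1 : Num.min c1 c2 <= c1 by rewrite ge_min lexx.
have cc2 : Num.min c1 c2 <= c2 by rewrite ge_min lexx orbT.
split => x x' h1 h2 h3.
  apply: (@le_trans _ _ (c1 * (x' - x) ^+ l.-1)).
    by apply: ler_wpM2r => //; rewrite exprn_ge0 // subr_ge0.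
  by apply: H1 => //; rewrite (le_trans h3) // lerD2l.
apply: (@le_trans _ _ (c2 * (x' - x) ^+ l.-1)).
  by apply: ler_wpM2r => //; rewrite exprn_ge0 // subr_ge0.
have := H2 (- x') (- x).
have -> : - x - - x' = x' - x by clear; ring.
have -> : D 1%N (- x) - D 1%N (- x') = f^`()%classic x' - f^`()%classic x.
  by rewrite /D expr1 !mulN1r !opprK !addr0 derive1n1; clear; ring.
apply; [by rewrite lerN2|by rewrite lerN2|].
by move: h1 rr2; move: (Num.min r1 r2) => m; clear; lra.
Qed.

(** * Hölder estimate near a point *)

(** Carries the value at [(t, y)] to the time [t']; the point [x] is the last vertex of a polygon
    run for exactly the time [|t' - t|]. *)
Lemma euler_reach (R : realType) (f F : R -> R) (U : R * R -> R)
    (G T1 T2 X1 X2 S vl vh sg r k zl zh om t y t' : R) :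
  local_balance f F U G T1 T2 X1 X2 S vl vh -> sg ^+ 2 = 1 -> 0 < r -> 0 < k ->
  (forall x x', zl <= x -> x <= x' -> x' <= zh -> 0 <= sg * (F x' - F x)) ->
  zl + om <= U (t, y) <= zh - om -> k <= om / 4 -> 2 * G * `|t' - t| <= om / 2 ->
  T1 <= t <= T2 -> T1 <= t' <= T2 ->
  X1 + r + S * `|t' - t| <= y <= X2 - r - S * `|t' - t| ->
  exists2 x, `|U (t', x) - U (t, y)| <= 2 * G * `|t' - t| + k & `|x - y| <= S * `|t' - t|.
Proof.
move=> lb sg2 r0 k0 mF Uz kom GT tT tT' yX.
have [E|tt'] := eqVneq t' t.
  by exists y; rewrite E ?subrr ?normr0 ?mulr0 // add0r ltW.
have T0 : 0 < `|t' - t| by rewrite normr_gt0 subr_eq0.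
have [th [th2 thE]] : exists th : R, th ^+ 2 = 1 /\ th * `|t' - t| = t' - t.
  have [h|h] := leP 0 (t' - t).
    by exists 1; rewrite expr1n mul1r ger0_norm.
  by exists (- 1); rewrite sqrrN expr1n mulN1r ltr0_norm // opprK.
have [h0 h00 traj] := euler_trajectory lb sg2 th2 r0 k0.
have [N [h [hp hh NT]]] := small_step T0 h00.
have hh0 : 0 < h <= h0 by rewrite hp.
have tT'' : T1 <= t + th * `|t' - t| <= T2 by rewrite thE addrC subrK.
have NT' : N%:R * h <= `|t' - t| by rewrite NT.
have [] := traj t y zl zh om `|t' - t| h mF Uz kom GT tT tT'' yX hh0 N NT'.
have -> : t + N%:R * (th * h) = t'.
  by rewrite mulrCA NT thE addrC subrK.
by rewrite NT => h1 h2; exists (euler (F \o U) t (th * h) y N).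
Qed.

(* The values [al] and [be] stay away from [v], where the monotonicity of the
   derivative of [f] may change. *)
Lemma zone_pair (R : realType) (v r a b : R) (Z : R -> R -> Prop) :
  Z v (v + r) -> Z (v - r) v -> `|a - v| <= r / 4 -> `|b - v| <= r / 4 ->
  exists zl zh al be, [/\ Z zl zh, `|al - be| = `|a - b| / 4,
    zl + `|a - b| / 4 <= al <= zh - `|a - b| / 4, zl + `|a - b| / 4 <= be <= zh - `|a - b| / 4 &
    Num.min a b <= al <= Num.max a b /\ Num.min a b <= be <= Num.max a b].
Proof.
move=> Zr Zl.
wlog ab : a b / a <= b.
  move=> H av bv; case/orP: (le_total a b) => [ab|ba]; first exact: H.
  by have := H b a ba bv av; rewrite [`|b - a|]distrC minC maxC.
rewrite (min_idPl ab) (max_idPr ab) [`|a - b|]distrC [`|b - a|]ger0_norm ?subr_ge0 //.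
rewrite !ler_norml => av bv.
(* If the midpoint is at least [v], the upper quarter of [a, b] lies above v + (b - a)/4; otherwise
   the lower quarter lies below v - (b - a)/4. *)
have [m|m] := leP v ((a + b) / 2).
  exists v, (v + r), (b - (b - a) / 4), b; split => //.
  - have -> : b - (b - a) / 4 - b = - ((b - a) / 4) by clear; ring.
    by rewrite normrN ger0_norm // divr_ge0 // subr_ge0.
  - by move: ab av bv m; clear; lra.
  - by move: ab av bv m; clear; lra.
  - by split; move: ab av bv m; clear; lra.
exists (v - r), v, (a + (b - a) / 4), a; split => //.
- by rewrite addrAC subrr add0r ger0_norm // divr_ge0 // subr_ge0.
- by move: ab av bv m; clear; lra.
- by move: ab av bv m; clear; lra.
- by split; move: ab av bv m; clear; lra.
Qed.

Lemma segment_ivt (R : realType) (U : R * R -> R) (P Q : R * R) (v : R) :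
  continuous U -> Num.min (U P) (U Q) <= v <= Num.max (U P) (U Q) ->
  exists2 s : R, 0 <= s <= 1 & U (P.1 + s * (Q.1 - P.1), P.2 + s * (Q.2 - P.2)) = v.
Proof.
move=> cU vPQ; pose h (s : R) := U (P.1 + s * (Q.1 - P.1), P.2 + s * (Q.2 - P.2)).
have ch : continuous h.
  move=> s; apply: (@continuous_comp _ _ _
    (fun s : R => (P.1 + s * (Q.1 - P.1), P.2 + s * (Q.2 - P.2)))); last exact: cU.
  apply: (@cvg_pair _ _ _ (nbhs s) (nbhs (P.1 + s * (Q.1 - P.1))) (nbhs (P.2 + s * (Q.2 - P.2)))).
    by apply: cvgD; [exact: cvg_cst|apply: cvgMl; exact: cvg_id].
  by apply: cvgD; [exact: cvg_cst|apply: cvgMl; exact: cvg_id].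
have h0 : h 0 = U P by rewrite /h !mul0r !addr0; case: (P).
have h1 : h 1 = U Q by rewrite /h !mul1r ![_ + (_ - _)]addrC !subrK; case: (Q).
have [|s s01 hs] := @IVT R h 0 1 v ler01 (continuous_subspaceT ch).
  by rewrite h0 h1.
by exists s => //; move: s01; rewrite in_itv.
Qed.

(** In the application one of the two points comes from a polygon, so the gap in values is known
    only up to a factor 2 on either side; hence the constants 8 and 32 around the 16 of the crossing
    time. *)
Lemma crossing_bound_dist (R : realType) (f F : R -> R) (U : R * R -> R)
    (G T1 T2 X1 X2 S vl vh sg r zl zh c t x1 x2 w : R) (n : nat) :
  local_balance f F U G T1 T2 X1 X2 S vl vh -> sg ^+ 2 = 1 -> 0 < r -> 0 <= c ->
  (forall x x', zl <= x -> x <= x' -> x' <= zh -> c * (x' - x) ^+ n <= sg * (F x' - F x)) ->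
  0 < w -> w / 2 <= `|U (t, x2) - U (t, x1)| <= 2 * w ->
  zl + w / 2 <= U (t, x1) <= zh - w / 2 -> zl + w / 2 <= U (t, x2) <= zh - w / 2 ->
  T1 <= t - w / (8 * G) -> t + w / (8 * G) <= T2 ->
  X1 + r + S * (w / (8 * G)) <= x1 <= X2 - r - S * (w / (8 * G)) ->
  X1 + r + S * (w / (8 * G)) <= x2 <= X2 - r - S * (w / (8 * G)) ->
  w / (32 * G) * (c * (w / 4) ^+ n) <= `|x2 - x1|.
Proof.
move=> lb sg2 r0 c0 sF w0.
wlog x12 : x1 x2 / x1 <= x2.
  move=> H w12 z1 z2 tT1 tT2 xX1 xX2; have [x12|x21] := leP x1 x2; first exact: H.
  by rewrite distrC; apply: H => //; [exact: ltW|rewrite distrC].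
move=> /andP[w1 w2] z1 z2 tT1 tT2 xX1 xX2.
have G0 := lb_source lb; have S0 := local_speed_ge0 lb.
have D0 : 0 < `|U (t, x2) - U (t, x1)|.
  by apply: lt_le_trans w1; rewrite divr_gt0.
have {x12} x12 : x1 < x2.
  rewrite lt_neqAle x12 andbT; apply: contraTneq D0 => ->; rewrite subrr normr0 ltxx //.
rewrite gtr0_norm ?subr_gt0 //.
have i0 (q : R) : 0 < q -> 0 < (q * G)^-1 by move=> q0; rewrite invr_gt0 mulr_gt0.
have TE : `|U (t, x2) - U (t, x1)| / (16 * G) <= w / (8 * G).
  have -> : w / (8 * G) = 2 * w / (16 * G) by field; rewrite gt_eqF.
  by apply: ler_wpM2r => //; exact/ltW/i0.
have TE' : w / (32 * G) <= `|U (t, x2) - U (t, x1)| / (16 * G).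
  have -> : w / (32 * G) = w / 2 / (16 * G) by field; rewrite gt_eqF.
  by apply: ler_wpM2r => //; exact/ltW/i0.
have ST := ler_wpM2l S0 TE.
have := @crossing_bound R f F U G T1 T2 X1 X2 S vl vh sg r zl zh c t x1 x2 n lb sg2 r0 c0 sF x12 D0.
move: w1 w2 TE TE' ST D0; move: (`|U (t, x2) - U (t, x1)| / (16 * G)) (`|U (t, x2) - U (t, x1)|) => T W w1 w2 TE TE' ST D0 cr.
apply: le_trans (cr _ _ _ _ _ _).
- apply: ler_pM => //.
  + by rewrite divr_ge0 ?mulr_ge0 // ltW.
  + by rewrite mulr_ge0 // exprn_ge0 // divr_ge0 // ltW.
  + apply: ler_wpM2l => //; apply: lerXn2r; rewrite ?nnegrE.
    * by rewrite divr_ge0 // ltW.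
    * by rewrite divr_ge0 // ltW.
    * by move: w1; clear; lra.
- by move: z1 w2; clear; lra.
- by move: z2 w2; clear; lra.
- by move: tT1 TE; clear; lra.
- by move: tT2 TE; clear; lra.
- by move: xX1 ST; clear; lra.
- by move: xX2 ST; clear; lra.
Qed.

Lemma local_estimate (R : realType) (f F : R -> R) (U : R * R -> R)
    (G S t0 x0 R0 v r c sg1 sg2 : R) (n : nat) :
  local_balance f F U G (t0 - R0) (t0 + R0) (x0 - R0) (x0 + R0) S (v - r / 4) (v + r / 4) ->
  0 < r -> 0 < c -> 0 < R0 -> sg1 ^+ 2 = 1 -> sg2 ^+ 2 = 1 -> r * (1 + S) <= 2 * R0 * G ->
  (forall x x', v <= x -> x <= x' -> x' <= v + r -> c * (x' - x) ^+ n <= sg1 * (F x' - F x)) ->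
  (forall x x', v - r <= x -> x <= x' -> x' <= v -> c * (x' - x) ^+ n <= sg2 * (F x' - F x)) ->
  exists2 C : R, 0 <= C & forall P Q : R * R,
    `|P.1 - t0| <= R0 / 4 -> `|P.2 - x0| <= R0 / 4 ->
    `|Q.1 - t0| <= R0 / 4 -> `|Q.2 - x0| <= R0 / 4 ->
    `|U P - U Q| ^+ n.+1 <= C * (`|P.1 - Q.1| + `|P.2 - Q.2|).
Proof.
move=> lb r0 c0 R00 sg12 sg22 rSG Z1 Z2.
have G0 := lb_source lb; have S0 := local_speed_ge0 lb.
(* [C1] serves points far apart in time. [K] solves the crossing bound at w = W/4 for W^(n+1), and 1
   + S accounts for the displacement along the polygon. *)
pose C1 := 64 * G * r ^+ n.
pose K := 4 ^+ n.+1 * (32 * G * 4 ^+ n / c).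
pose C2 := K * (1 + S).
have K0 : 0 <= K.
  rewrite mulr_ge0 ?exprn_ge0 // divr_ge0 ?(ltW c0) // mulr_ge0 ?exprn_ge0 //.
  by rewrite mulr_ge0 // ltW.
have C10 : 0 <= C1 by rewrite !mulr_ge0 ?exprn_ge0 // ltW.
have C20 : 0 <= C2 by rewrite mulr_ge0 // addr_ge0.
exists (C1 + C2); first by rewrite addr_ge0.
move=> P Q Pt Px Qt Qx.
have d0 : 0 <= `|P.1 - Q.1| + `|P.2 - Q.2| by rewrite addr_ge0.
have [UPQ|UPQ] := eqVneq (U P) (U Q).
  by rewrite UPQ subrr normr0 expr0n /= mulr_ge0 // addr_ge0.
pose W := `|U P - U Q|; have W0 : 0 < W by rewrite normr_gt0 subr_eq0.
have range z : `|U z - v| <= r / 4.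
  by have := lb_range lb z; rewrite ler_norml; clear; lra.
pose Z zl zh := exists2 sg : R, sg ^+ 2 = 1 & forall x x', zl <= x -> x <= x' -> x' <= zh ->
  c * (x' - x) ^+ n <= sg * (F x' - F x).
have Zr : Z v (v + r) by exists sg1.
have Zl : Z (v - r) v by exists sg2.
have [zl [zh [al [be [[sg sg2' sF] abE alz bez [alI beI]]]]]] :=
  zone_pair Zr Zl (range P) (range Q).
rewrite -/W in abE alz bez; pose w := W / 4; rewrite -/w in abE alz bez.
have w0 : 0 < w by rewrite divr_gt0.
have wr : w <= r / 8.
  have : W <= `|U P - v| + `|U Q - v|.
    have -> : W = `|(U P - v) - (U Q - v)| by rewrite /W; congr (`|_|); clear; ring.
    exact: ler_normB.
  by rewrite /w; move: (range P) (range Q); clear; lra.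
have [s1 s1I U1] := segment_ivt (lb_continuous lb) alI.
have [s2 s2I U2] := segment_ivt (lb_continuous lb) beI.
pose t1 := P.1 + s1 * (Q.1 - P.1); pose x1 := P.2 + s1 * (Q.2 - P.2).
pose t2 := P.1 + s2 * (Q.1 - P.1); pose x2 := P.2 + s2 * (Q.2 - P.2).
rewrite -/t1 -/x1 in U1; rewrite -/t2 -/x2 in U2.
have between (s p q o e : R) : 0 <= s <= 1 -> `|p - o| <= e -> `|q - o| <= e ->
    `|p + s * (q - p) - o| <= e.
  move=> /andP[sp s1'] po qo.
  have -> : p + s * (q - p) - o = (1 - s) * (p - o) + s * (q - o) by clear; ring.
  have s1'' : 0 <= 1 - s by rewrite subr_ge0.
  rewrite (le_trans (ler_normD _ _)) // !normrM (ger0_norm sp) (ger0_norm s1'').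
  have := ler_wpM2l sp qo; have := ler_wpM2l s1'' po.
  by clear; lra.
have t1b : `|t1 - t0| <= R0 / 4 by exact: between.
have x1b : `|x1 - x0| <= R0 / 4 by exact: between.
have t2b : `|t2 - t0| <= R0 / 4 by exact: between.
have x2b : `|x2 - x0| <= R0 / 4 by exact: between.
have shrink (p q : R) : `|(p + s2 * (q - p)) - (p + s1 * (q - p))| <= `|p - q|.
  have -> : (p + s2 * (q - p)) - (p + s1 * (q - p)) = (s1 - s2) * (p - q) by clear; ring.
  rewrite normrM -[leRHS]mul1r; apply: ler_wpM2r => //.
  by rewrite ler_norml; move: s1I s2I; clear; lra.
have tt : `|t2 - t1| <= `|P.1 - Q.1| by exact: shrink.
have xx : `|x2 - x1| <= `|P.2 - Q.2| by exact: shrink.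
have W4 : W = 4 * w by rewrite /w; clear; lra.
have Wr : W <= r by move: wr r0; rewrite W4; clear; lra.
(* If the times differ by at least w/(16G), then [W] is at most a multiple of that difference, and
   W^n <= r^n does the rest. Otherwise the polygon from [(t1, x1)] reaches the time [t2] with a loss
   in value of at most 3w/16. *)
have [far|near] := leP (w / (16 * G)) `|t2 - t1|.
  have Wt : W <= 64 * G * `|P.1 - Q.1|.
    move: (le_trans far tt); rewrite ler_pdivrMr ?mulr_gt0 // W4.
    by move: (`|P.1 - Q.1|) => a; clear; rewrite mulrA; lra.
  have h1 : W ^+ n.+1 <= C1 * `|P.1 - Q.1|.
    have -> : C1 * `|P.1 - Q.1| = 64 * G * `|P.1 - Q.1| * r ^+ n by rewrite /C1; clear; ring.
    rewrite exprS; apply: ler_pM => //; first exact: ltW.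
      by rewrite exprn_ge0 // ltW.
    by apply: lerXn2r => //; rewrite nnegrE; exact: ltW.
  apply: le_trans h1 _; apply: ler_pM => //; first by rewrite lerDl.
  by rewrite lerDl.
have GT : 2 * G * `|t2 - t1| <= w / 8.
  by move: near; rewrite ltr_pdivlMr ?mulr_gt0 //; move: (`|_|) => a; rewrite mulrA; clear; lra.
(* This is where [rSG] enters: from within R0/4 of the centre, the polygon to [t2], the crossing
   time and the margin R0/4 for the strips together stay inside the box. *)
have T8 : w / (8 * G) * (1 + S) <= R0 / 4.
  have h : w * (1 + S) <= R0 / 4 * (8 * G).
    have S1 : 0 <= 1 + S by rewrite addr_ge0.
    have RG : 0 <= R0 * G by rewrite mulr_ge0 // ltW.
    by have := ler_wpM2r S1 wr; move: rSG RG; clear; lra.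
  by rewrite mulrAC ler_pdivrMr ?mulr_gt0.
have T80 : 0 <= w / (8 * G) by rewrite divr_ge0 ?mulr_ge0 ?ltW.
have ST80 : 0 <= S * (w / (8 * G)) by rewrite mulr_ge0.
have T8' : w / (8 * G) + S * (w / (8 * G)) <= R0 / 4 by move: T8; clear; lra.
have near' : `|t2 - t1| <= w / (8 * G).
  apply: ltW; apply: lt_le_trans near _; apply: ler_wpM2l; first exact: ltW.
  by rewrite lef_pV2 ?posrE ?mulr_gt0 // ler_pM2r // ler_nat.
have Snear : S * `|t2 - t1| <= S * (w / (8 * G)) by apply: ler_wpM2l.
have Snear0 : 0 <= S * `|t2 - t1| by rewrite mulr_ge0.
have mF x x' : zl <= x -> x <= x' -> x' <= zh -> 0 <= sg * (F x' - F x).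
  move=> h1 h2 h3; apply: le_trans (sF _ _ h1 h2 h3).
  by rewrite mulr_ge0 ?exprn_ge0 ?subr_ge0 // ltW.
have r40 : 0 < R0 / 4 by rewrite divr_gt0.
have k0 : 0 < w / 16 by rewrite divr_gt0.
move: (t1b) (x1b) (t2b) (x2b); rewrite !ler_norml => t1c x1c t2c x2c.
have [||||||y Uy yx] := euler_reach lb sg2' r40 k0 mF (t := t1) (y := x1) (t' := t2) (om := w).
- by rewrite U1.
- by move: w0; clear; lra.
- by move: GT w0; move: (2 * _ * _) => a; clear; lra.
- by move: t1c R00; clear; lra.
- by move: t2c R00; clear; lra.
- by move: x1c R00 Snear T8' T80; clear; lra.
rewrite U1 in Uy; move: (yx) (Uy); rewrite !ler_norml => yx' Uy'.
have Uclose : `|U (t2, y) - al| <= 3 / 16 * w.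
  by move: Uy GT; move: (2 * _ * _) (`|_|) => a b; clear; lra.
move: (Uclose); rewrite ler_norml => Uc.
have gap : w / 2 <= `|U (t2, x2) - U (t2, y)| <= 2 * w.
  rewrite U2; move: abE Uc w0; move: (U (t2, y)) => a.
  have [h|h] := leP 0 (al - be); have [h'|h'] := leP 0 (be - a);
    rewrite ?(ger0_norm h) ?(ltr0_norm h) ?(ger0_norm h') ?(ltr0_norm h');
    by move: h h'; clear; lra.
have zy : zl + w / 2 <= U (t2, y) <= zh - w / 2 by move: Uc alz w0; clear; lra.
have zx : zl + w / 2 <= U (t2, x2) <= zh - w / 2 by rewrite U2; move: bez w0; clear; lra.
have cr : w / (32 * G) * (c * (w / 4) ^+ n) <= `|x2 - y|.
  apply: (crossing_bound_dist lb sg2' r40 (ltW c0) sF w0 gap zy zx).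
  - by move: t2c R00 T8' ST80; clear; lra.
  - by move: t2c R00 T8' ST80; clear; lra.
  - by move: x1c yx' R00 Snear T8' T80; clear; lra.
  - by move: x2c R00 T8' T80 ST80; clear; lra.
have dist : `|x2 - y| <= (1 + S) * (`|P.1 - Q.1| + `|P.2 - Q.2|).
  have -> : x2 - y = (x2 - x1) - (y - x1) by clear; ring.
  rewrite (le_trans (ler_normB _ _)) //.
  have h1 := ler_wpM2l S0 tt; have h2 : 0 <= S * `|P.2 - Q.2| by rewrite mulr_ge0.
  move: h1 h2 yx xx (normr_ge0 (P.1 - Q.1)); rewrite mulrDl mul1r mulrDr.
  by clear; lra.
have h2 : W ^+ n.+1 <= C2 * (`|P.1 - Q.1| + `|P.2 - Q.2|).
  have wE (q : R) : (4 * q) ^+ n.+1 = K * (q / (32 * G) * (c * (q / 4) ^+ n)).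
    rewrite /K exprMn expr_div_n [q ^+ n.+1]exprS; field.
    by rewrite expf_neq0 ?pnatr_eq0 // !gt_eqF.
  rewrite W4 wE /C2 -[leRHS]mulrA; apply: ler_wpM2l => //.
  exact: le_trans cr dist.
apply: le_trans h2 _; apply: ler_wpM2r => //; by rewrite lerDr.
Qed.

(** * From a neighbourhood to compact sets *)

Definition clamp (R : realType) (a b x : R) : R := Num.max a (Num.min b x).

Lemma clamp_itv (R : realType) (a b x : R) : a <= b -> a <= clamp a b x <= b.
Proof. by move=> ab; rewrite /clamp le_max lexx /= ge_max ab ge_min lexx. Qed.

Lemma clamp_id (R : realType) (a b x : R) : a <= x <= b -> clamp a b x = x.
Proof. by move=> /andP[ax xb]; rewrite /clamp (min_idPr xb) (max_idPr ax). Qed.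

Lemma clamp_lipschitz (R : realType) (a b x y : R) : `|clamp a b x - clamp a b y| <= `|x - y|.
Proof.
wlog xy : x y / x <= y.
  move=> H; case/orP: (le_total x y) => [|yx]; first exact: H.
  by rewrite distrC [leRHS]distrC; exact: H.
rewrite [leRHS]distrC [leRHS]ger0_norm ?subr_ge0 // ler_norml /clamp !maxEle !minEle.
by do !case: ifPn; rewrite -?ltNge; move: xy; clear; lra.
Qed.

Lemma continuous_clamp (R : realType) (a b : R) : continuous (clamp a b).
Proof.
move=> x; apply/cvgrPdist_lt => e e0; near=> y.
apply: le_lt_trans (clamp_lipschitz a b x y) _; near: y.
by have := @cvg_id _ (nbhs x); move/cvgrPdist_lt; apply.
Unshelve. all: by end_near. Qed.

Section clamped_extension.
Context {R : realType}.
Variables (Omega : set (R * R)) (u : R * R -> R) (T1 T2 X1 X2 : R).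
Hypothesis oO : open Omega.
Hypothesis cu : {within Omega, continuous u}.
Hypothesis T12 : T1 <= T2.
Hypothesis X12 : X1 <= X2.
Hypothesis QO : `[T1, T2] `*` `[X1, X2] `<=` Omega.

(** Composition with the retraction onto the box keeps the range that [u] has there and makes
    uniform continuity hold on the whole plane, as the fields [lb_range] and [lb_unif] demand. *)
Definition clamped (z : R * R) := u (clamp T1 T2 z.1, clamp X1 X2 z.2).

Let clamp_box z : (`[T1, T2] `*` `[X1, X2]) (clamp T1 T2 z.1, clamp X1 X2 z.2).
Proof. by split => /=; rewrite in_itv /=; exact: clamp_itv. Qed.

Lemma clampedE z : (`[T1, T2] `*` `[X1, X2]) z -> clamped z = u z.
Proof.
by move=> [/=]; rewrite !in_itv /= => z1 z2; rewrite /clamped !clamp_id //; case: (z).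
Qed.

Lemma continuous_clamped : continuous clamped.
Proof.
have cu' : {in Omega, continuous u} by rewrite -continuous_open_subspace.
move=> z; apply: (@continuous_comp _ _ _
  (fun z : R * R => (clamp T1 T2 z.1, clamp X1 X2 z.2)) u); last first.
  by apply: cu'; rewrite inE; apply: QO; exact: clamp_box.
apply: (@cvg_pair _ _ _ (nbhs z) (nbhs (clamp T1 T2 z.1)) (nbhs (clamp X1 X2 z.2))).
  by apply: continuous_fst; exact: continuous_clamp.
apply: (@continuous_comp _ _ _ snd (clamp X1 X2)); first exact: cvg_snd.
exact: continuous_clamp.
Qed.

Lemma clamped_unif (k : R) : 0 < k -> exists2 d, 0 < d &
  forall t t' x x', `|t - t'| <= d -> `|x - x'| <= d ->
    `|clamped (t, x) - clamped (t', x')| <= k.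
Proof.
move=> k0; have cQ : compact (`[T1, T2] `*` `[X1, X2] : set (R * R)).
  by apply: compact_setX; exact: segment_compact.
pose P (d : R) (z : R * R) := forall z' : R * R, `|z.1 - z'.1| <= d -> `|z.2 - z'.2| <= d ->
  `|clamped z - clamped z'| <= k.
have [d [d0 Pd]] : exists d, 0 < d /\ (`[T1, T2] `*` `[X1, X2]) `<=` P d.
  have nc : forall z, (`[T1, T2] `*` `[X1, X2]) z ->
      \forall z' \near z & d \near (0 : R)^'+, P d z'.
    move=> z _; have k20 : 0 < k / 2 by rewrite divr_gt0.
    have /cvgrPdist_lt/(_ _ k20)/nbhs_ballP[e /= e0 He] := @continuous_clamped z.
    have e20 : 0 < e / 2 by rewrite divr_gt0.
    exists (ball z (e / 2), [set d | d < e / 2]).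
      split => /=; first exact: nbhsx_ballx.
      exact: nbhs_right_lt.
    move=> [z' d] /= [zz' de] z'' z1 z2.
    have b1 : ball z e z' by apply: le_ball zz'; rewrite ler_pdivrMr // mulr_natr mulr2n lerDl ltW.
    have b2 : ball z e z''.
      case: zz' => zz1 zz2; split; rewrite /ball /= in zz1 zz2 *.
        apply: le_lt_trans (ler_distD z'.1 _ _) _.
        by rewrite [ltRHS]splitr ltrD // (le_lt_trans z1 de).
      apply: le_lt_trans (ler_distD z'.2 _ _) _.
      by rewrite [ltRHS]splitr ltrD // (le_lt_trans z2 de).
    have h1 := He _ b1; have h2 := He _ b2; rewrite /= in h1 h2.
    apply: le_trans (ler_distD (clamped z) _ _) _; rewrite [`|clamped z' - _|]distrC.
    by rewrite [leRHS]splitr lerD // ltW.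
  have nP := (compact_near_coveringP _).1 cQ R (0 : R)^'+ P _ nc.
  near (0 : R)^'+ => d; exists d; split; near: d.
    exact: nbhs_right_gt.
  exact: nP.
exists d => // t t' x x' tt' xx'.
have E s y : clamped (s, y) = clamped (clamp T1 T2 s, clamp X1 X2 y).
  by rewrite /clamped /= !(clamp_id (clamp_itv _ _)).
rewrite E [clamped (t', x')]E; apply: (Pd _ (clamp_box (t, x))) => /=.
  exact: le_trans (clamp_lipschitz _ _ _ _) tt'.
exact: le_trans (clamp_lipschitz _ _ _ _) xx'.
Unshelve. all: by end_near. Qed.

End clamped_extension.

Lemma continuous_segment_bounded (R : realType) (F : R -> R) (a b : R) :
  continuous F -> exists M, forall x, a <= x <= b -> `|F x| <= M.
Proof.
move=> cF; have : compact (F @` `[a, b]).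
  by apply: continuous_compact; [exact: continuous_subspaceT|exact: segment_compact].
move/compact_bounded => [M [_ HM]]; exists (M + 1) => x xab.
by apply: (HM (M + 1)); [rewrite ltrDl|exists x => //=; rewrite in_itv].
Qed.

Lemma local_holder (R : realType) (l : nat) (f : R -> R)
    (Omega : set (R * R)) (u g : R * R -> R) (P0 : R * R) :
  (2 <= l)%N -> is_Ck l f -> nonlinear f l%:R -> open Omega ->
  {within Omega, continuous u} -> Linfty Omega g -> balance_law Omega f u g ->
  Omega P0 ->
  exists C R1 : R, [/\ 0 < R1, 0 <= C & forall P Q : R * R,
    `|P.1 - P0.1| <= R1 -> `|P.2 - P0.2| <= R1 ->
    `|Q.1 - P0.1| <= R1 -> `|Q.2 - P0.2| <= R1 ->
    `|u P - u Q| ^+ l <= C * (`|P.1 - Q.1| + `|P.2 - Q.2|)].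
Proof.
move=> l2 Cf nf oO cu gL bal OP0.
have [r [c [sg1 [sg2 [r0 c0 sg12 sg22 [Z1 Z2]]]]]] := local_zones (u P0) l2 Cf nf.
have [g1 [G' [mg1 mg g1G' gg1]]] := Linfty_bounded_representative gL.
have cu' : {in Omega, continuous u} by rewrite -continuous_open_subspace.
have r40 : 0 < r / 4 by rewrite divr_gt0.
(* On the box [u] stays within r/4 of its value at [P0], so every value met lies well inside the two
   monotonicity zones. *)
have [R0 [R00 R0O R0u]] : exists R0, [/\ 0 < R0,
    `[P0.1 - R0, P0.1 + R0] `*` `[P0.2 - R0, P0.2 + R0] `<=` Omega &
    forall z, (`[P0.1 - R0, P0.1 + R0] `*` `[P0.2 - R0, P0.2 + R0]) z -> `|u P0 - u z| <= r / 4].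
  have : \forall z \near P0, Omega z /\ `|u P0 - u z| < r / 4.
    apply: filterI; first exact: open_nbhs_nbhs.
    have /cvgrPdist_lt := cu' P0 (mem_set OP0); exact.
  move=> /nbhs_ballP[e /= e0 He]; exists (e / 2); split; first by rewrite divr_gt0.
    move=> z [/= z1 z2]; suff /He[] : ball P0 e z by [].
    by move: z1 z2; rewrite !in_itv /= => z1 z2; split; rewrite /ball /= ltr_norml;
      move: z1 z2 e0; clear; lra.
  move=> z [/= z1 z2]; suff /He[_ /ltW] : ball P0 e z by [].
  by move: z1 z2; rewrite !in_itv /= => z1 z2; split; rewrite /ball /= ltr_norml;
    move: z1 z2 e0; clear; lra.
have l0 : (0 < l)%N by exact: ltnW.
have cF : continuous f^`()%classic.
  by case: Cf => _ /(_ 1%N); rewrite derive1n1; apply; exact: ltnW.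
have [S HS] := continuous_segment_bounded (u P0 - r / 4) (u P0 + r / 4) cF.
have S0 : 0 <= S.
  apply: le_trans (normr_ge0 _) (HS (u P0) _); move: r40; clear; lra.
have q0 : 0 <= r * (1 + S) / (2 * R0).
  by rewrite divr_ge0 ?mulr_ge0 ?addr_ge0 // ltW.
(* The 1 makes [G] positive even without a source; the last term is chosen to give [rSG]. *)
pose G := `|G'| + 1 + r * (1 + S) / (2 * R0).
have G0 : 0 < G by rewrite /G; move: (normr_ge0 G') q0; clear; lra.
have T12 : P0.1 - R0 <= P0.1 + R0 by move: R00; clear; lra.
have X12 : P0.2 - R0 <= P0.2 + R0 by move: R00; clear; lra.
pose U := clamped u (P0.1 - R0) (P0.1 + R0) (P0.2 - R0) (P0.2 + R0).
have cU : continuous U by exact: (continuous_clamped oO cu T12 X12 R0O).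
have hf x : is_derive x (1 : R) f (f^`()%classic x) by exact: (is_Ck_derive Cf l0).
have cf : continuous f.
  by move=> x; apply: differentiable_continuous; apply/derivable1_diffP; case: (hf x).
have UE z : (`[P0.1 - R0, P0.1 + R0] `*` `[P0.2 - R0, P0.2 + R0]) z -> U z = u z.
  exact: clampedE.
have lb : local_balance f f^`()%classic U G (P0.1 - R0) (P0.1 + R0) (P0.2 - R0) (P0.2 + R0)
    S (u P0 - r / 4) (u P0 + r / 4).
  split => //.
  - move=> z; have : `|u P0 - U z| <= r / 4.
      by apply: R0u; split => /=; rewrite in_itv /=; exact: clamp_itv.
    by rewrite ler_norml; clear; lra.
  - by move=> k k0; exact: (clamped_unif oO cu T12 X12 R0O k0).
  - have g1G z : `|g1 z| <= G.
      apply: le_trans (g1G' z) _; rewrite /G.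
      by move: (ler_norm G') q0; clear; lra.
    exact: (strip_evolution cU cf R0O UE bal mg mg1 g1G gg1).
have rSG : r * (1 + S) <= 2 * R0 * G.
  have R20 : 0 < 2 * R0 by rewrite mulr_gt0.
  rewrite [leRHS]mulrC -ler_pdivrMr // /G.
  by move: (normr_ge0 G'); clear; lra.
have [C C0 HC] := local_estimate lb r0 c0 R00 sg12 sg22 rSG Z1 Z2.
exists C, (R0 / 4); split => //; first by rewrite divr_gt0.
move=> P Q P1 P2 Q1 Q2; have := HC P Q P1 P2 Q1 Q2.
rewrite prednK //.
have inQ (z : R * R) : `|z.1 - P0.1| <= R0 / 4 -> `|z.2 - P0.2| <= R0 / 4 ->
    (`[P0.1 - R0, P0.1 + R0] `*` `[P0.2 - R0, P0.2 + R0]) z.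
  by rewrite !ler_norml => z1 z2; split => /=; rewrite in_itv /=; move: z1 z2 R00; clear; lra.
by rewrite !UE //; exact: inQ.
Qed.

(** By compactness of K x K it suffices to argue near each pair: on the diagonal the local estimate
    applies; near a pair of distinct points [u] is bounded and the distance is bounded below, so any
    large [C] works. *)
Lemma holder_on_compact (R : realType) (l : nat) (Omega K : set (R * R)) (u : R * R -> R) :
  {in Omega, continuous u} ->
  (forall P0, Omega P0 -> exists C R1 : R, [/\ 0 < R1, 0 <= C & forall P Q : R * R,
    `|P.1 - P0.1| <= R1 -> `|P.2 - P0.2| <= R1 ->
    `|Q.1 - P0.1| <= R1 -> `|Q.2 - P0.2| <= R1 ->
    `|u P - u Q| ^+ l <= C * (`|P.1 - Q.1| + `|P.2 - Q.2|)]) ->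
  compact K -> K `<=` Omega ->
  exists2 C : R, 0 <= C & forall P Q, K P -> K Q ->
    `|u P - u Q| ^+ l <= C * (`|P.1 - Q.1| + `|P.2 - Q.2|).
Proof.
move=> cu loc cK KO.
pose H (C : R) (z : (R * R) * (R * R)) :=
  `|u z.1 - u z.2| ^+ l <= C * (`|z.1.1 - z.2.1| + `|z.1.2 - z.2.2|).
have cKK : compact (K `*` K) by exact: compact_setX.
have nc : forall z, (K `*` K) z -> \forall z' \near z & C \near (+oo : set_system R), H C z'.
  move=> [P Q] [/= KP KQ].
  have [<-|PQ] := eqVneq P Q.
    have [C [R1 [R10 C0 HC]]] := loc P (KO _ KP).
    exists (ball (P, P) R1, [set C' | C <= C']).
      split => /=; first exact: nbhsx_ballx.
      by apply: nbhs_pinfty_ge; rewrite num_real.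
    move=> [[P' Q'] C'] /= [[[p1 p2] [q1 q2]] CC'].
    rewrite /ball /= in p1 p2 q1 q2.
    have := HC P' Q'; rewrite ![`|_ - P.1|]distrC ![`|_ - P.2|]distrC.
    move=> /(_ (ltW p1) (ltW p2) (ltW q1) (ltW q2)) h.
    by apply: le_trans h _; apply: ler_wpM2r => //; exact: addr_ge0.
  pose d := `|P.1 - Q.1| + `|P.2 - Q.2|.
  have d0 : 0 < d.
    rewrite lt_neqAle addr_ge0 // andbT eq_sym paddr_eq0 // !normr_eq0 !subr_eq0.
    by apply: contra PQ => /andP[/eqP h1 /eqP h2]; apply/eqP; case: (P) (Q) h1 h2 => [? ?] [? ?] /= -> ->.
  have /cvgrPdist_lt/(_ _ ltr01)/nbhs_ballP[e1 /= e10 He1] := cu P (mem_set (KO _ KP)).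
  have /cvgrPdist_lt/(_ _ ltr01)/nbhs_ballP[e2 /= e20 He2] := cu Q (mem_set (KO _ KQ)).
  pose M := `|u P - u Q| + 2.
  have M0 : 0 <= M by rewrite addr_ge0.
  (* Moving both points by less than [e] costs at most 2e in each coordinate, hence 4e <= d/2 in
     all. *)
  pose e := Num.min (d / 8) (Num.min e1 e2).
  have e0 : 0 < e by rewrite !lt_min e10 e20 divr_gt0.
  have ed : e <= d / 8 by rewrite ge_min lexx.
  have ee1 : e <= e1 by rewrite /e !ge_min lexx /= orbT.
  have ee2 : e <= e2 by rewrite /e !ge_min lexx /= !orbT.
  exists (ball (P, Q) e, [set C' | M ^+ l / (d / 2) <= C']).
    split => /=; first exact: nbhsx_ballx.
    by apply: nbhs_pinfty_ge; rewrite num_real.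
  move=> [[P' Q'] C'] /= [[bP bQ] CC'].
  have /= uP := He1 _ (le_ball ee1 bP); have /= uQ := He2 _ (le_ball ee2 bQ).
  have uM : `|u P' - u Q'| <= M.
    have -> : u P' - u Q' = (u P - u Q) + ((u Q - u Q') - (u P - u P')) by clear; ring.
    apply: le_trans (ler_normD _ _) _; rewrite lerD2l.
    by apply: le_trans (ler_normB _ _) _; move: uP uQ; clear; lra.
  case: bP bQ => p1 p2 [q1 q2]; rewrite /ball /= in p1 p2 q1 q2.
  have tri (a b a' b' : R) : `|a - a'| < e -> `|b - b'| < e ->
      `|a - b| <= `|a' - b'| + 2 * e.
    move=> aa bb; have -> : a - b = (a' - b') + ((a - a') - (b - b')) by clear; ring.
    apply: le_trans (ler_normD _ _) _; rewrite lerD2l.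
    by apply: le_trans (ler_normB _ _) _; move: aa bb; clear; lra.
  have d2 : d / 2 <= `|P'.1 - Q'.1| + `|P'.2 - Q'.2|.
    have := tri _ _ _ _ p1 q1; have := tri _ _ _ _ p2 q2.
    by rewrite /d in ed *; move: ed; clear; lra.
  apply: (@le_trans _ _ (M ^+ l)); first by apply: lerXn2r; rewrite ?nnegrE.
  have d20 : 0 < d / 2 by rewrite divr_gt0.
  have C'0 : 0 <= C' by apply: le_trans CC'; rewrite divr_ge0 ?exprn_ge0 // ltW.
  move: CC'; rewrite ler_pdivrMr // => h; apply: le_trans h _.
  exact: ler_wpM2l.
have nH := (compact_near_coveringP _).1 cKK R (+oo : set_system R) H _ nc.
near (+oo : set_system R) => C; exists C; first by near: C; apply: nbhs_pinfty_ge; rewrite num_real.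
have HC : K `*` K `<=` (fun z => H C z) by near: C; exact: nH.
by move=> P Q KP KQ; exact: (HC (P, Q)).
Unshelve. all: by end_near. Qed.

Theorem proposition3p1 (R : realType) (l : nat) (f : R -> R)
    (Omega : set (R * R)) (u g : R * R -> R) :
  (2 <= l)%N ->
  is_Ck l f ->
  nonlinear f l%:R ->
  open Omega ->
  connected Omega ->
  {within Omega, continuous u} ->
  Linfty Omega g ->
  balance_law Omega f u g ->
  locally_holder Omega (l%:R^-1) u.
Proof.
move=> l2 Cf nf oO _ cu gL bal K cK KO.
have cu' : {in Omega, continuous u} by rewrite -continuous_open_subspace.
have loc P0 (OP0 : Omega P0) := local_holder l2 Cf nf oO cu gL bal OP0.
have [C C0 HC] := holder_on_compact cu' loc cK KO.
(* The factor 2 passes from the sum of the coordinate distances to the Euclidean distance, before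
   the l-th root is taken. *)
exists ((2 * C) `^ l%:R^-1) => P Q KP KQ.
have l0 : l%:R != 0 :> R by rewrite pnatr_eq0; case: (l) l2.
have E0 : 0 <= euclid_dist P Q by exact: sqrtr_ge0.
have C20 : 0 <= 2 * C by rewrite mulr_ge0.
have dE : `|P.1 - Q.1| + `|P.2 - Q.2| <= 2 * euclid_dist P Q.
  have h1 : `|P.1 - Q.1| <= euclid_dist P Q.
    by rewrite -sqrtr_sqr; apply: ler_wsqrtr; rewrite lerDl sqr_ge0.
  have h2 : `|P.2 - Q.2| <= euclid_dist P Q.
    by rewrite -sqrtr_sqr; apply: ler_wsqrtr; rewrite lerDr sqr_ge0.
  by move: h1 h2; clear; lra.
have h : `|u P - u Q| ^+ l <= 2 * C * euclid_dist P Q.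
  apply: le_trans (HC P Q KP KQ) _.
  by rewrite [2 * C]mulrC -mulrA; exact: ler_wpM2l.
rewrite -powRM //.
have -> : `|u P - u Q| = (`|u P - u Q| ^+ l) `^ l%:R^-1.
  by rewrite -powR_mulrn // -powRrM mulfV // powRr1.
apply: ge0_ler_powR => //; rewrite ?nnegrE ?invr_ge0 ?exprn_ge0 //.
by rewrite mulr_ge0.
Qed.
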